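(* Let $d\in\{1,2,3\}$, let $\mathcal{R}$ be a finite interaction range and let $V\in C^3((\mathbb{R}^d)^{\mathcal{R}};\mathbb{R})$ be a site potential that is point symmetric with respect to $\sim$. Let $Y\in C^3(\mathbb{R}^d;\mathbb{R}^d)$ be a $1$-periodic deformation field and $P\in C^3(\mathbb{R}^d;\mathbb{R}^d)$ a $1$-periodic shift field (with some macroscopic strain $B\in \mathrm{GL}(d)$). For $N\in\mathbb{N}$ let $Y^N(x):=N\,Y(x/N)$, $P^N(x):=P(x/N)$, and let $y^N:\mathbb{Z}^d\times\{0,1\}\to\mathbb{R}^d$ be the atomistic deformation $$y^N_0(\xi):=Y^N(\xi),\qquad y^N_1(\xi):=Y^N(\xi)+P^N(\xi)\qquad(\xi\in\mathbb{Z}^d).$$ Define $$\mathscr{E}^{\rm c}(Y^N,P^N):=\int_{N\Omega}V\big(\nabla_{\mathcal{R}}(Y^N,P^N)(x)\big)\,dx,\qquad \nabla_{\boldsymbol{\rho}}(Y^N,P^N):=\nabla_\rho Y^N+(\beta-\alpha)P^N+\tfrac{\alpha+\beta}{2}\nabla_\rho P^N$$ for $\boldsymbol{\rho}=(\rho;\alpha,\beta)\in\mathcal{R}$, where $N\Omega=[0,N)^d$. Then $$N^{-d}\left|\mathscr{E}^{\rm a}(y^N)-\mathscr{E}^{\rm c}(Y^N,P^N)\right|\le C\,N^{-2}\left\{\|\nabla^3Y\|_\infty+\|\nabla^3P\|_\infty+\|\nabla^2P\|_\infty+\|\nabla^2Y\|_\infty^2+\|\nabla P\|_\infty^2\right\},$$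 where the constant $C$ depends only on $\mathcal{R}$ and $\|V\|_{C^2}$.
   Context: Interaction range: $\mathcal{R}$ is a finite subset of $\mathbb{Z}^d\times\{0,1\}\times\{0,1\}\setminus\{(0;0,0),(0;1,1)\}$; its elements are written $\boldsymbol{\rho}=(\rho;\alpha,\beta)$. Atomistic energy: an atomistic deformation is a map $y:\mathbb{Z}^d\times\{0,1\}\to\mathbb{R}^d$, with $y_\alpha(\xi):=y(\xi,\alpha)$. Put $D_{\boldsymbol{\rho}}y(\xi):=y_\beta(\xi+\rho)-y_\alpha(\xi)$ and $D_{\mathcal{R}}y(\xi):=(D_{\boldsymbol{\rho}}y(\xi))_{\boldsymbol{\rho}\in\mathcal{R}}$. The deformation $y$ is $N$-periodic if $y_\alpha(\xi)=B\xi+u_\alpha(\xi)$ for some $B\in \mathrm{GL}(d)$ and some $u:\mathbb{Z}^d\times\{0,1\}\to\mathbb{R}^d$ with $u_\alpha(\xi+N\eta)=u_\alpha(\xi)$ for all $\xi,\eta\in\mathbb{Z}^d$. For an $N$-periodic deformation $y$, with $\Omega_N:=\{0,1,\dots,N-1\}^d$, $$\mathscr{E}^{\rm a}(y):=\sum_{\xi\in\Omega_N}V(D_{\mathcal{R}}y(\xi)).$$ Point symmetry with respect to $\sim$: let $\sim(\rho;\alpha,\beta):=(-\rho;\beta,\alpha)$. $V$ is point symmetric with respect to $\sim$ if $\sim\mathcal{R}=\mathcal{R}$ and $V(\{g_{\boldsymbol{\rho}}\}_{\boldsymbol{\rho}\in\mathcal{R}})=V(\{-g_{\sim\boldsymbol{\rho}}\}_{\boldsymbol{\rho}\in\mathcal{R}})$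 for all $\{g_{\boldsymbol{\rho}}\}\in(\mathbb{R}^d)^{\mathcal{R}}$. The case of interest is the pair interaction potential $V(\boldsymbol{g})=\frac12\sum_{\boldsymbol{\rho}\in\mathcal{R}}\phi_{\alpha\beta}(|g_{\boldsymbol{\rho}}|)$ with $\phi_{\alpha\beta}=\phi_{\beta\alpha}$ and $\sim\mathcal{R}=\mathcal{R}$. Continuum fields: a pair $(Y,P)$ of a deformation field and a shift field on $\mathbb{R}^d$ is $N$-periodic if, for some $B\in\mathrm{GL}(d)$, $P(x+N\eta)=P(x)$ and $Y(x+N\eta)=NB\eta+Y(x)$ for all $x\in\mathbb{R}^d$, $\eta\in\mathbb{Z}^d$. Directional derivatives: $\nabla_\rho f(x):=\nabla f(x)\rho$. $\nabla_{\mathcal{R}}(Y,P)(x):=\{\nabla_{\boldsymbol{\rho}}(Y,P)(x)\}_{\boldsymbol{\rho}\in\mathcal{R}}$. Norms: $\|\cdot\|_\infty$ is the supremum norm on $\mathbb{R}^d$; $\|V\|_{C^k}$ is the usual $C^k$ norm of $V$ (suprema of $V$ and its derivatives up to order $k$), taken to be finite. *)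

(* Defs.v *)
From HB Require Import structures.
From mathcomp Require Import all_boot all_order all_algebra finmap.
From mathcomp Require Import all_classical all_reals all_analysis.

Set Implicit Arguments.
Unset Strict Implicit.
Unset Printing Implicit Defensive.

Import Order.TTheory GRing.Theory Num.Theory numFieldNormedType.Exports.

Local Open Scope classical_set_scope.
Local Open Scope ring_scope.

(* The library proves this but exports no instance for it. *)
Lemma sigma_finite_product_measure1 (d1 d2 : measure_display)
    (T1 : measurableType d1) (T2 : measurableType d2) (K : realType)
    (m1 : {sigma_finite_measure set T1 -> \bar K})
    (m2 : {sigma_finite_measure set T2 -> \bar K}) :
  sigma_finite setT (m1 \x m2)%E.
Proof.
have /sigma_finiteP[F [TF ndF Foo]] := sigma_finiteT m1.
have /sigma_finiteP[G [TG ndG Goo]] := sigma_finiteT m2.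
exists (fun n => F n `*` G n).
  rewrite -setXTT TF TG predeqE => -[x y]; split.
    move=> [/= [n _ Fnx] [k _ Gky]]; exists (maxn n k) => //; split.
    - by move: x Fnx; exact/subsetPset/ndF/leq_maxl.
    - by move: y Gky; exact/subsetPset/ndG/leq_maxr.
  by move=> [n _ []/= ? ?]; split; exists n.
move=> k; have [? ?] := Foo k; have [? ?] := Goo k.
split; first exact: measurableX.
by rewrite product_measure1E// lte_mul_pinfty// ge0_fin_numE.
Qed.

Section cons_measure.
Context (d : measure_display) (T : measurableType d) (K : realType) (n : nat).
Variable m1 : {sigma_finite_measure set T -> \bar K}.
Variable m2 : {sigma_finite_measure set (n.-tuple T) -> \bar K}.

Definition tcons (p : (T * n.-tuple T)%type) : n.+1.-tuple T :=
  [tuple of p.1 :: p.2].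

Definition tuncons (t : n.+1.-tuple T) : (T * n.-tuple T)%type :=
  (thead t, [tuple of behead t]).

Lemma measurable_tcons : measurable_fun setT tcons.
Proof. exact: measurable_cons. Qed.

Lemma measurable_tuncons : measurable_fun setT tuncons.
Proof.
apply/measurable_fun_pairP; split => /=.
  exact (measurable_tnth ord0).
exact (@measurable_behead _ T n).
Qed.

Lemma tconsK : cancel tcons tuncons.
Proof. by case=> x t; congr pair; apply: val_inj. Qed.

(* The product measure, transported to (n + 1)-tuples. *)
Definition cons_measure : set (n.+1.-tuple T) -> \bar K :=
  pushforward (m1 \x m2)%E tcons.

Let measurable_preimage_tcons (A : set (n.+1.-tuple T)) :
  measurable A -> measurable (tcons @^-1` A).
Proof.
by move=> mA; rewrite -[X in measurable X]setTI; exact: measurable_tcons.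
Qed.

Let cons_measure0 : cons_measure set0 = 0%E.
Proof. by rewrite /cons_measure /pushforward preimage_set0 measure0. Qed.

Let cons_measure_ge0 A : (0 <= cons_measure A)%E.
Proof. by rewrite /cons_measure /pushforward; exact: measure_ge0. Qed.

Let cons_measure_sigma_additive : semi_sigma_additive cons_measure.
Proof.
move=> F mF tF mUF; rewrite /cons_measure /pushforward preimage_bigcup.
apply: measure_semi_sigma_additive.
- by move=> i; exact: measurable_preimage_tcons.
- apply/trivIsetP => /= i j _ _ ij; rewrite -preimage_setI.
  by move/trivIsetP : tF => /(_ _ _ _ _ ij) ->//; rewrite preimage_set0.
- by rewrite -preimage_bigcup; exact: measurable_preimage_tcons.
Qed.

HB.instance Definition _ := isMeasure.Build _ _ _ cons_measure
  cons_measure0 cons_measure_ge0 cons_measure_sigma_additive.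

Let cons_measure_sigma_finite : sigma_finite setT cons_measure.
Proof.
have [F UF FP] : sigma_finite setT (m1 \x m2)%E 
  by exact: sigma_finite_product_measure1.
exists (fun i => tuncons @^-1` F i).
  by rewrite -preimage_bigcup -UF preimage_setT.
move=> i; have [mF Foo] := FP i; split.
  by rewrite -[X in measurable X]setTI; exact: measurable_tuncons.
rewrite /cons_measure /pushforward (_ : tcons @^-1` _ = F i)//.
by apply/seteqP; split => p; rewrite /preimage/= tconsK.
Qed.

HB.instance Definition _ := Measure_isSigmaFinite.Build _ _ _
  cons_measure cons_measure_sigma_finite.

End cons_measure.

(* Lebesgue measure on K^n, as the n-fold product of the one-dimensional
   Lebesgue measure, on the product sigma-algebra of n.-tuple K. *)
Fixpoint lebesgue_tuple (K : realType) (n : nat) :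
    {sigma_finite_measure set (n.-tuple (measurableTypeR K)) -> \bar K} :=
  if n is n'.+1 then cons_measure (@lebesgue_measure K) (lebesgue_tuple K n')
  else dirac ([tuple] : 0.-tuple (measurableTypeR K)).

Definition vec_of_tuple (K : realType) (n : nat) (t : n.-tuple K) : 'cV[K]_n :=
  \col_i tnth t i.

Section differentiability.
Context (K : realType).

Fixpoint Cn (U W : normedModType K) (k : nat) (f : U -> W) : Prop :=
  if k is k'.+1 then
    (forall x, differentiable f x) /\ (forall v, Cn k' ('D_v f))
  else continuous f.

Context (m n : nat) (W : normedModType K).
Implicit Type f : 'M[K]_(m, n) -> W.

Definition partial (s : seq ('I_m * 'I_n)) f : 'M[K]_(m, n) -> W :=
  foldr (fun ij g => 'D_(delta_mx ij.1 ij.2) g) f s.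

(* |nabla^k f(x)|: the largest norm of a k-th order partial derivative, in line
   with the max-norm that the library puts on matrices. *)
Definition nabla_norm (k : nat) f (x : 'M[K]_(m, n)) : K :=
  \big[Num.max/0]_(s : k.-tuple ('I_m * 'I_n)) `|partial s f x|.

Definition nabla_sup (k : nat) f : \bar K :=
  ereal_sup (range (fun x => (nabla_norm k f x)%:E)).

Definition Cn_norm (k : nat) f : \bar K :=
  (\sum_(j < k.+1) nabla_sup j f)%E.

End differentiability.

Section lattice.
Context (d : nat).

(* (rho, alpha, beta) stands for (rho; alpha, beta); {0,1} is bool. *)
Definition bond : Type := ('cV[int]_d * bool * bool)%type.

Definition flip (r : bond) : bond := let: (rho, a, b) := r in (- rho, b, a).

Definition interaction_range (R : {fset bond}) : Prop :=
  (0, false, false) \notin R /\ (0, true, true) \notin R.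

Context (K : realType).

Definition zvec (xi : 'cV[int]_d) : 'cV[K]_d := map_mx intr xi.

(* An element of (K^d)^R is the d x #|R| matrix whose columns are the g_rho,
   for rho running through the enumeration of R; [stencil] restricts a
   family indexed by all bonds to R. *)
Definition stencil (R : {fset bond}) (g : bond -> 'cV[K]_d) :
    'M[K]_(d, #|` R|) :=
  \matrix_(i, j) g (tnth (in_tuple R) j) i 0.

Definition point_symmetric (R : {fset bond}) (V : 'M[K]_(d, #|` R|) -> K) :=
  [fset flip r | r in R]%fset = R /\
  forall g : bond -> 'cV[K]_d,
    V (stencil R g) = V (stencil R (fun r => - g (flip r))).

Definition fdiff (y : 'cV[int]_d -> bool -> 'cV[K]_d) (xi : 'cV[int]_d)
    (r : bond) : 'cV[K]_d :=
  let: (rho, a, b) := r in y (xi + rho) b - y xi a.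

Definition energy_a (R : {fset bond}) (V : 'M[K]_(d, #|` R|) -> K) (N : nat)
    (y : 'cV[int]_d -> bool -> 'cV[K]_d) : K :=
  \sum_(xi : 'cV['I_N]_d)
    V (stencil R (fdiff y (map_mx (fun i : 'I_N => i%:Z) xi))).

Definition periodic_fields (N : nat) (B : 'M[K]_d)
    (Y P : 'cV[K]_d -> 'cV[K]_d) :=
  forall (x : 'cV[K]_d) (eta : 'cV[int]_d),
    P (x + N%:R *: zvec eta) = P x /\
    Y (x + N%:R *: zvec eta) = N%:R *: (B *m zvec eta) + Y x.

Definition cdiff (Y P : 'cV[K]_d -> 'cV[K]_d) (x : 'cV[K]_d) (r : bond) :
    'cV[K]_d :=
  let: (rho, a, b) := r in
  'D_(zvec rho) Y x + (b%:R - a%:R) *: P x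
  + ((a%:R + b%:R) / 2) *: 'D_(zvec rho) P x.

Definition cube (N : nat) : set (d.-tuple (measurableTypeR K)) :=
  [set t | forall i, 0 <= tnth t i < N%:R].

Definition energy_c (R : {fset bond}) (V : 'M[K]_(d, #|` R|) -> K) (N : nat)
    (Y P : 'cV[K]_d -> 'cV[K]_d) : K :=
  \int[lebesgue_tuple K d]_(t in cube N)
    V (stencil R (cdiff Y P (vec_of_tuple t))).

Definition rescale_deformation (N : nat) (Y : 'cV[K]_d -> 'cV[K]_d) (x : 'cV[K]_d) :=
  N%:R *: Y (N%:R^-1 *: x).

Definition rescale_shift (N : nat) (P : 'cV[K]_d -> 'cV[K]_d) (x : 'cV[K]_d) :=
  P (N%:R^-1 *: x).

Definition atomistic (Y P : 'cV[K]_d -> 'cV[K]_d) (xi : 'cV[int]_d) (a : bool) :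
    'cV[K]_d :=
  if a then Y (zvec xi) + P (zvec xi) else Y (zvec xi).

End lattice.

(* Main.v *)
Require Import Defs.
From HB Require Import structures.
From mathcomp Require Import all_boot all_order all_algebra finmap.
From mathcomp Require Import all_classical all_reals all_analysis.
From mathcomp Require Import measurable_realfun ring lra.

Set Implicit Arguments.
Unset Strict Implicit.
Unset Printing Implicit Defensive.

Import Order.TTheory GRing.Theory Num.Theory numFieldNormedType.Exports.
Local Open Scope classical_set_scope.
Local Open Scope ring_scope.

(** Write h = 1/N and G(x) for the stencil of the rescaled continuum strains
    at x.  Both energies are N^d times averages of values of V near the values
    of G: the atomistic one is the sum of V over the difference stencils at the
    points of the grid hZ^d, the continuum one is the integral of V o G.  They
    are compared through the sum of V o G over the grid.

    Difference stencil against G, at one grid point.  Taylor expansion of the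
    differences gives G + e + r, where the correction e of order h is built
    from the second derivative of Y and the first derivative of P, and where r
    is of order h^2.  The flip of a bond changes the sign of G and leaves e
    unchanged -- this is why the continuum strain carries the average
    (alpha + beta)/2 in front of the gradient of P -- so point symmetry of V
    says that V(G + e) = V(G - e).  Hence 2 (V(G + e) - V(G)) is a second
    difference of V, of order |e|^2, and the first-order error disappears
    (lemma site_error).

    Grid sum against integral.  V o G is periodic, and summing the midpoint
    rule over a period turns the error into second differences only: for a
    function of one variable each unit cell centred at an integer contributes
    at most the largest second difference (lemma midpoint_rule).  Fubini's
    theorem gives the same for a function of several variables, one coordinate
    at a time (lemma tensor_midpoint_rule); the integrand only has to be
    bounded and separately continuous, because such functions are measurable.
    The second differences of V o G along a coordinate step of length h are
    estimated by the same lemma on second differences of V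
    (lemma potential_second_difference); only the C^2 norm of V enters.

    One term of that estimate, h^4 |nabla^2 P|^2, is not on the right-hand
    side of the theorem.  If h^2 |nabla^2 P| <= 1 it is at most
    h^2 |nabla^2 P|; otherwise h^2 |nabla^2 P| > 1 and the bound on V alone
    is enough (lemma coordinate_second_difference_le).

    When one of the suprema is infinite, so is the right-hand side, since the
    constant is chosen positive. *)

(** * The midpoint rule for a periodic function of one variable *)

(** Restricting to the line through x in direction v turns directional
    derivatives into derivatives of functions of one variable, to which the
    mean value theorem applies. *)
Lemma is_derive_lineP (K : realType) (U W : normedModType K) (f : U -> W)
    (x v : U) (t : K) (l : W) :
  is_derive (x + t *: v) v f l <-> is_derive t 1 (fun s : K => f (x + s *: v)) l.
Proof.
have E : (fun h : K => h^-1 *: (((fun s : K => f (x + s *: v)) \o shift t) (h *: 1)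
             - f (x + t *: v)))
   = (fun h : K => h^-1 *: ((f \o shift (x + t *: v)) (h *: v) - f (x + t *: v))).
  apply/funext => h /=; congr (_ *: (f _ - _)).
  by rewrite [h *: 1]mulr1 scalerDl addrCA.
by split; case=> df <-; split; rewrite /derivable /derive ?E// -E.
Qed.

Lemma is_derive_line (K : realType) (U W : normedModType K) (f : U -> W)
    (x v : U) (t : K) (l : W) :
  is_derive (x + t *: v) v f l -> is_derive t 1 (fun s : K => f (x + s *: v)) l.
Proof. by case: (is_derive_lineP f x v t l). Qed.

Section quadrature1.
Context (K : realType).
Implicit Types (h H : K -> K).

Lemma mean_value_le h dh (a b M : K) : a <= b ->
  (forall x, a <= x <= b -> is_derive x 1 h (dh x)) ->
  (forall x, a <= x <= b -> `|dh x| <= M) ->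
  `|h b - h a| <= M * (b - a).
Proof.
move=> ab dhE dhM.
have [c cab ->] : exists2 c, c \in `[a, b] & h b - h a = dh c * (b - a).
  apply: MVT_segment => //.
    by move=> x; rewrite in_itv/= => /andP[ax xb]; apply: dhE; rewrite !ltW.
  apply: derivable_within_continuous => x; rewrite in_itv/= => xab.
  by have [] := dhE _ xab.
rewrite normrM ler_pM// ?dhM//; first by rewrite ger0_norm// subr_ge0.
Qed.

(** The derivative of t |-> H(c + t) - H(c - t) - 2 t h(c) is the second
    difference of h at c, so the mean value theorem on [0, 1/2] gives the error
    of the midpoint rule on the cell centred at c without differentiating h. *)
Lemma midpoint_cell h H (c M : K) :
  (forall x, `|x - c| <= 1 / 2 -> is_derive x 1 H (h x)) ->
  (forall s, 0 <= s <= 1 -> `|h (c + s) + h (c - s) - 2 * h c| <= M) ->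
  `|H (c + 1 / 2) - H (c - 1 / 2) - h c| <= M.
Proof.
move=> HE hM.
(* H is differentiable only near c, hence the restriction to t <= 1/2. *)
pose phi (t : K) : K := H (c + t) - H (c - t) - t * (2 * h c).
have phiE (t : K) : 0 <= t <= 1 / 2 ->
    is_derive t 1 phi (h (c + t) + h (c - t) - 2 * h c).
  move=> /andP[t0 t1].
  have line (e : K) : `|e| = 1 ->
      is_derive t 1 (fun s : K => H (c + s *: e)) (e * h (c + t * e)).
    move=> e1; apply: is_derive_line.
    have d1 : is_derive (c + t *: e) 1 H (h (c + t * e)).
      by apply: HE; rewrite addrAC subrr add0r normrM e1 mulr1 ger0_norm.
    have /derivable1_diffP dH := @ex_derive _ _ _ _ _ _ _ d1.
    split; first exact: diff_derivable.
    rewrite deriveE//; have -> : 'd H (c + t *: e) e = e *: 'd H (c + t *: e) 1.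
      by rewrite -linearZ [e *: 1]mulr1.
    by rewrite -deriveE// (@derive_val _ _ _ _ _ _ _ d1).
  have := is_deriveB (is_deriveB (line 1 (normr1 _)) (line (-1) (normrN1 _)))
    (is_deriveM (is_derive_id t 1) (is_derive_cst (2 * h c) t 1)).
  rewrite scaler0 add0r mul1r mulN1r opprK mulr1 mulrN1 [(2 * h c) *: 1]mulr1.
  congr is_derive; apply/funext => s; rewrite /phi.
  by rewrite -[LHS]/(H (c + s * 1) - H (c + s * -1) - s * (2 * h c)) mulr1 mulrN1.
have M0 : 0 <= M by apply: le_trans (hM 0 _); rewrite ?lexx ?ler01.
have le01 : (0 : K) <= 1 / 2 by lra.
have := @mean_value_le phi _ 0 (1/2) M le01 phiE.
have -> : phi (1 / 2) - phi 0 = H (c + 1 / 2) - H (c - 1 / 2) - h c.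
  by rewrite /phi addr0 subr0; field.
move=> H1; apply: le_trans (H1 _) _.
  by move=> x /andP[x0 x1]; apply: hM; rewrite x0/=; lra.
by rewrite subr0 ler_piMr//; lra.
Qed.

(** The base point a lies to the left of every point of interest, so that
    the fundamental theorem applies in the interior of its domain. *)
Lemma continuous_primitive h (a : K) : continuous h ->
  exists2 H : K -> K, forall x, a < x -> is_derive x 1 H (h x)
    & forall x y, a < x <= y ->
      \int[lebesgue_measure]_(t in `[x, y[) h t = H y - H x.
Proof.
move=> ch; pose H x := \int[lebesgue_measure]_(t in `[a, x]) h t.
have ih (b c : K) : lebesgue_measure.-integrable `[b, c] (EFin \o h).
  apply: continuous_compact_integrable; first exact: segment_compact.
  exact: continuous_subspaceT.
exists H => [x ax|x y /andP[ax xy]].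
  have xx : x < x + 1 by rewrite ltrDl.
  have [dH dHE] := @continuous_FTC1_closed _ h a x (x + 1) xx (ih _ _) ax (ch x).
  by apply: DeriveDef; [exact: dH|rewrite -derive1E; exact: dHE].
rewrite /H Rintegral_itvB//=; last by rewrite bnd_simp ltW.
have ioc : lebesgue_measure.-integrable `]x, y] (EFin \o h).
  by apply: integrableS (ih x y) => //; exact: subset_itv_oc_cc.
have ico : lebesgue_measure.-integrable `[x, y[ (EFin \o h).
  by apply: integrableS (ih x y) => //; exact: subset_itv_co_cc.
by rewrite Rintegral_itv_bndo_bndc// Rintegral_itv_obnd_cbnd.
Qed.

(** By periodicity the integral over [0, N[ is also the integral over
    [-1/2, N - 1/2[, a disjoint union of unit cells centred at the integers
    0, ..., N - 1, and the errors of the cells add up. *)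
Lemma midpoint_rule h (N : nat) (M : K) :
  continuous h -> (forall x, h (x + N%:R) = h x) ->
  (forall c s, 0 <= s <= 1 -> `|h (c + s) + h (c - s) - 2 * h c| <= M) ->
  `|\sum_(k < N) h k%:R - \int[lebesgue_measure]_(x in `[0, N%:R[) h x|
    <= N%:R * M.
Proof.
move=> ch pN hM.
(* The leftmost cell starts at -1/2, inside the domain of H. *)
have [H HE ->] := @continuous_primitive h (-1) ch; last first.
  by rewrite ler0n andbT ltrN10.
have -> : H N%:R - H 0 = H (N%:R - 1 / 2) - H (- (1 / 2)).
  pose phi x := H (x + N%:R) - H x.
  have phiE (x : K) : -1 < x -> is_derive x 1 phi 0.
    move=> x1; rewrite -(subrr (h x)) -{1}(pN x); apply: is_deriveB; last exact: HE.
    have HN : is_derive (N%:R + x *: (1 : K) : K) 1 H (h (x + N%:R)).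
      rewrite addrC [x *: 1]mulr1; apply: HE; rewrite (lt_le_trans x1)// lerDl.
      exact: ler0n.
    have := is_derive_line HN.
    by congr is_derive; apply/funext => s; rewrite addrC [s *: 1]mulr1.
  have h0 : - (1 / 2) <= 0 :> K by lra.
  have := @mean_value_le phi (cst 0) _ _ 0 h0 _ _.
  rewrite mul0r normr_le0 subr_eq0 => /(_ _ _)/eqP.
  rewrite /phi add0r [_ + N%:R]addrC; apply => [x /andP[x1 _]|x _].
    by apply: phiE; lra.
  by rewrite normr0.
have -> : H (N%:R - 1 / 2) - H (- (1 / 2)) =
    \sum_(k < N) (H (k%:R + 1 / 2) - H (k%:R - 1 / 2)).
  rewrite -(big_mkord xpredT (fun k => H (k%:R + 1 / 2) - H (k%:R - 1 / 2))).
  under eq_bigr => k _.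
    rewrite (_ : k%:R + 1 / 2 = k.+1%:R - 1 / 2); last by rewrite -natr1; field.
    over.
  by rewrite (telescope_sumr (fun k => H (k%:R - 1 / 2)))// sub0r.
rewrite -sumrB (le_trans (ler_norm_sum _ _ _))// mulr_natl.
have -> : M *+ N = \sum_(k < N) M by rewrite sumr_const card_ord.
rewrite ler_sum// => k _.
rewrite distrC; apply: midpoint_cell => [x xk|c s]; last exact: hM.
move: xk; rewrite ler_norml => /andP[x1 _].
apply: HE; have : 0 <= k%:R :> K by []. 
lra.
Qed.

End quadrature1.

(** * Separately continuous functions are measurable *)

Section separate.
Context (K : realType).

(** g is the pointwise limit of the functions obtained by rounding x down
    to a multiple of 1/(m + 1); these take the form of countably many measurable
    functions of t glued along a partition of the line into intervals. *)
Lemma measurable_caratheodory d (T : measurableType d)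
    (g : measurableTypeR K * T -> K) :
  (forall t, continuous (fun x : K => g (x, t))) ->
  (forall x, measurable_fun setT (fun t => g (x, t))) ->
  measurable_fun setT g.
Proof.
move=> cg mg.
pose fl (m : nat) (x : K) : int := Num.floor (m.+1%:R * x).
pose gm (m : nat) (p : measurableTypeR K * T) := g ((fl m p.1)%:~R / m.+1%:R, p.2).
apply: (@measurable_fun_cvg _ _ _ setT gm g).
  move=> m _ A mA; rewrite setTI.
  have -> : gm m @^-1` A = \bigcup_(z : int)
      ([set x : measurableTypeR K | z%:~R <= m.+1%:R * x < (z + 1)%:~R]
        `*` ((fun t => g (z%:~R / m.+1%:R, t)) @^-1` A)).
    apply/seteqP; split => [[x t] /= At|[x t] [z _ [/= zx At]]].
      by exists (fl m x) => //; split => //=; exact: floor_itv.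
    by rewrite /gm /= /fl (floor_def zx).
  apply: countable_bigcupT_measurable => [|z]; first exact: countableP.
  apply: measurableX; last by rewrite -[X in measurable X]setTI; exact: mg.
  rewrite [X in measurable X](_ : _ =
      `[z%:~R / m.+1%:R, (z + 1)%:~R / m.+1%:R[%classic).
    exact: measurable_itv.
  apply/seteqP; split => x; rewrite /= in_itv/= ler_pdivrMr ?ltr0Sn//.
    by rewrite ltr_pdivlMr ?ltr0Sn// mulrC.
  by rewrite ltr_pdivlMr ?ltr0Sn// mulrC.
move=> [x t] _; rewrite /gm/=.
apply: (@cvg_comp _ _ _ (fun m => (fl m x)%:~R / m.+1%:R)
  (fun y => g (y, t)) _ (nbhs x)).
  apply/cvgrPdist_le => e e0.
  have /cvgrPdist_le/(_ e e0) := @cvg_harmonic K; apply: filterS => m.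
  rewrite sub0r normrN; apply: le_trans.
  rewrite (ger0_norm (harmonic_ge0 _)) /harmonic.
  have m0 : 0 < m.+1%:R :> K by [].
  have /andP[lo hi] := floor_itv (m.+1%:R * x).
  rewrite -(ler_pM2r m0) mulVf ?gt_eqF// -[X in _ * X](gtr0_norm m0).
  rewrite -normrM mulrBl divfK// mulrC ler_norml; move: lo hi.
  by rewrite /fl intrD; lra.
exact: cg.
Qed.

Definition upd n (t : n.-tuple (measurableTypeR K)) (i : 'I_n)
    (x : measurableTypeR K) : n.-tuple (measurableTypeR K) :=
  [tuple (if j == i then x else tnth t j) | j < n].

Lemma tnth_tcons0 n (t : n.-tuple (measurableTypeR K)) (x : measurableTypeR K) :
  tnth (tcons (x, t)) ord0 = x.
Proof. by rewrite tnth0. Qed.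

Lemma tnth_tconsS n (t : n.-tuple (measurableTypeR K)) (x : measurableTypeR K) i :
  tnth (tcons (x, t)) (lift ord0 i) = tnth t i.
Proof. by rewrite tnthS. Qed.

Lemma upd_tcons0 n (t : n.-tuple (measurableTypeR K)) (x y : measurableTypeR K) :
  upd (tcons (x, t)) ord0 y = tcons (y, t).
Proof.
apply: eq_from_tnth => j; rewrite tnth_mktuple.
case: (unliftP ord0 j) => [k|] ->; last by rewrite eqxx tnth_tcons0.
by rewrite !tnth_tconsS.
Qed.

Lemma upd_tconsS n (t : n.-tuple (measurableTypeR K)) (i : 'I_n) (x y : measurableTypeR K) :
  upd (tcons (x, t)) (lift ord0 i) y = tcons (x, upd t i y).
Proof.
apply: eq_from_tnth => j; rewrite tnth_mktuple.
case: (unliftP ord0 j) => [k|] ->; last by rewrite !tnth_tcons0.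
by rewrite (inj_eq lift_inj) !tnth_tconsS tnth_mktuple.
Qed.

(** Lebesgue's theorem: induction on the dimension, the first coordinate
    being the continuous variable of a Caratheodory function. *)
Lemma measurable_separately_continuous n (f : n.-tuple (measurableTypeR K) -> K) :
  (forall t i, continuous (fun x : K => f (upd t i x))) ->
  measurable_fun setT f.
Proof.
elim: n f => [|n IH] f cf.
  rewrite (_ : f = cst (f [tuple])); last by apply/funext => t; rewrite tuple0.
  exact: measurable_cst.
have -> : f = (f \o @tcons _ _ n) \o @tuncons _ _ n.
  by apply/funext => t /=; congr f; rewrite [LHS]tuple_eta.
apply: measurableT_comp; last exact: measurable_tuncons.
apply: measurable_caratheodory => [t|x].
  have := cf (tcons (0 : measurableTypeR K, t)) ord0.
  by under [X in continuous X]eq_fun do rewrite upd_tcons0.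
apply: IH => t i.
have := cf (tcons (x : measurableTypeR K, t)) (lift ord0 i).
by under [X in continuous X]eq_fun do rewrite upd_tconsS.
Qed.

End separate.

(** * Integration over a cube, one coordinate at a time *)

Section product_integral.
Context (K : realType).

Lemma bounded_integrable d (T : measurableType d)
    (mu : {measure set T -> \bar K}) (A : set T) (g : T -> K) (c : K) :
  measurable A -> (mu A < +oo)%E -> measurable_fun setT g ->
  (forall x, `|g x| <= c) -> mu.-integrable A (EFin \o g).
Proof.
move=> mA Aoo mg gc; apply: measurable_bounded_integrable => //.
  exact: measurable_funTS.
exists c; split; first exact: num_real.
by move=> M cM x _; rewrite /= (le_trans (gc x))// ltW.
Qed.

(** Fubini's theorem, for real-valued integrals over a measurable rectangle:
    extend g by zero outside the rectangle.  The integrability of the inner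
    integral is needed to compare it with other functions of t. *)
Lemma Rintegral_product d1 d2 (T1 : measurableType d1) (T2 : measurableType d2)
    (m1 : {sigma_finite_measure set T1 -> \bar K})
    (m2 : {sigma_finite_measure set T2 -> \bar K})
    (A : set T1) (B : set T2) (g : T1 * T2 -> K) (c : K) :
  measurable A -> measurable B -> (m1 A < +oo)%E -> (m2 B < +oo)%E ->
  measurable_fun setT g -> (forall p, `|g p| <= c) ->
  m2.-integrable B (fun t => (\int[m1]_(x in A) g (x, t))%:E) /\
  \int[(m1 \x m2)%E]_(p in A `*` B) g p =
    \int[m2]_(t in B) \int[m1]_(x in A) g (x, t).
Proof.
move=> mA mB Aoo Boo mg gc.
have iA t : m1.-integrable A (fun x => (g (x, t))%:E).
  apply: (@bounded_integrable _ _ m1 A (fun x => g (x, t)) c) => //.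
  exact: measurableT_comp.
have mAB : measurable (A `*` B) by exact: measurableX.
have ABoo : ((m1 \x m2)%E (A `*` B) < +oo)%E.
  by rewrite product_measure1E// lte_mul_pinfty// ge0_fin_numE.
have ig : (m1 \x m2)%E.-integrable (A `*` B) (EFin \o g).
  exact: bounded_integrable gc.
have ig' : (m1 \x m2)%E.-integrable setT ((EFin \o g) \_ (A `*` B)).
  by apply/integrable_restrict => //; rewrite setTI.
have GE : fubini_G m1 ((EFin \o g) \_ (A `*` B)) =
    (fun t => (\int[m1]_(x in A) g (x, t))%:E) \_ B.
  apply/funext => t; rewrite /fubini_G /patch; case: ifPn => tB.
    rewrite /Rintegral fineK; last exact: integrable_fin_num.
    rewrite [RHS]integral_mkcond; apply: eq_integral => x _.
    by rewrite /patch in_setX tB andbT.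
  apply: integral0_eq => x _.
  by rewrite in_setX (negPf tB) andbF.
split.
  apply: measurable_bounded_integrable => //.
    have := measurable_fubini_G ig'; rewrite GE.
    move=> H; apply/measurable_EFinP.
    exact: (measurable_restrictT _ mB).2 H.
  exists (c * fine (m1 A)); split; first exact: num_real.
  move=> M cM t _; apply: (le_trans _ (ltW cM)).
  rewrite (le_trans (le_normr_Rintegral mA (iA t)))//.
  rewrite -Rintegral_cst//; apply: le_Rintegral => //.
    have := iA t; exact: integrable_abse.
  exact: (@bounded_integrable _ _ m1 A (cst c) `|c|).
rewrite /Rintegral; congr fine.
rewrite integral_mkcond -integral21_prod_meas1// GE.
by rewrite -integral_mkcond.
Qed.

Lemma measurable_cube n (N : nat) : measurable (@cube n K N).
Proof.
rewrite (_ : cube N = \bigcap_(i in [set: 'I_n])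
    ((fun t : n.-tuple (measurableTypeR K) => tnth t i) @^-1` `[0, N%:R[%classic)).
  apply: fin_bigcap_measurable => [|i _]; first exact: finite_finset.
  rewrite -[X in measurable X]setTI.
  by apply: measurable_tnth => //; exact: measurable_itv.
apply/seteqP; split => t /= H i; first by move=> _; rewrite /= in_itv/= H.
by have := H i I; rewrite /= in_itv.
Qed.

Lemma tcons_preimage_cube n (N : nat) :
  @tcons _ (measurableTypeR K) n @^-1` (cube N) = `[0, N%:R[%classic `*` cube N.
Proof.
apply/seteqP; split => [[x t]/= H|[x t]/= [x0 H] i].
  split => [|i] /=; first by have := H ord0; rewrite tnth_tcons0 in_itv.
  by have := H (lift ord0 i); rewrite tnth_tconsS.
case: (unliftP ord0 i) => [k|] ->; first by rewrite tnth_tconsS.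
by rewrite tnth_tcons0; move: x0; rewrite in_itv.
Qed.

Lemma lebesgue_itv0N (N : nat) :
  lebesgue_measure (`[0, N%:R[%classic : set (measurableTypeR K)) = N%:R%:E.
Proof.
rewrite lebesgue_measure_itv/= lte_fin; case: ltP => [_|].
  by rewrite sube0.
by rewrite lern0 => /eqP ->.
Qed.

Lemma lebesgue_tuple_cube n (N : nat) :
  lebesgue_tuple K n (cube N) = (N%:R ^+ n)%:E.
Proof.
elim: n => [|n IH] /=.
  rewrite diracE mem_set//; by move=> [].
rewrite /cons_measure /pushforward tcons_preimage_cube product_measure1E//.
  rewrite exprS EFinM -IH; congr (_ * _)%E; exact: lebesgue_itv0N.
exact: measurable_cube.
Qed.

(** The measure on (n + 1)-tuples is the image of a product measure, so an
    integral over a cube is an iterated integral; the first coordinate is the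
    inner variable, which lets the rule in one variable be applied pointwise. *)
Lemma Rintegral_cube_cons n (N : nat) (f : n.+1.-tuple (measurableTypeR K) -> K)
    (c : K) :
  measurable_fun setT f -> (forall t, `|f t| <= c) ->
  (lebesgue_tuple K n).-integrable (cube N)
    (fun t => (\int[lebesgue_measure]_(x in `[0, N%:R[) f (tcons (x, t)))%:E) /\
  \int[lebesgue_tuple K n.+1]_(t in cube N) f t =
  \int[lebesgue_tuple K n]_(t in cube N)
     \int[lebesgue_measure]_(x in `[0, N%:R[) f (tcons (x, t)).
Proof.
move=> mf fc.
have mfc : measurable_fun setT (f \o @tcons _ (measurableTypeR K) n).
  by apply: measurableT_comp => //; exact: measurable_tcons.
pose I : set (measurableTypeR K) := `[0, N%:R[%classic.
have Ioo : (lebesgue_measure I < +oo)%E by rewrite lebesgue_itv0N ltry.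
have Coo : (lebesgue_tuple K n (cube N) < +oo)%E.
  by rewrite lebesgue_tuple_cube ltry.
have mI : measurable I by exact: measurable_itv.
have [i1 i2] := @Rintegral_product _ _ _ _ (@lebesgue_measure K)
  (lebesgue_tuple K n) _ _ _ c mI (@measurable_cube n N) Ioo Coo mfc (fun p => fc _).
split => //.
rewrite -[RHS]i2 /Rintegral; congr fine.
rewrite /= /cons_measure integral_pushforward//.
- by rewrite tcons_preimage_cube.
- exact: measurable_tcons.
- exact/measurable_EFinP.
- rewrite tcons_preimage_cube; apply: bounded_integrable => //.
  + by apply: measurableX => //; exact: measurable_cube.
  + rewrite /= product_measure1E//; last exact: measurable_cube.
    by rewrite lte_mul_pinfty// ge0_fin_numE.
- exact: measurable_cube.
Qed.

End product_integral.

(** * The midpoint rule for a periodic function of several variables *)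

Section quadrature.
Context (K : realType).

Lemma Rintegral_sum d (T : measurableType d) (mu : {measure set T -> \bar K})
    (D : set T) (N : nat) (h : 'I_N -> T -> K) :
  measurable D -> (forall i, mu.-integrable D (EFin \o h i)) ->
  \int[mu]_(x in D) \sum_i h i x = \sum_i \int[mu]_(x in D) h i x.
Proof.
move=> mD ih; rewrite /Rintegral.
rewrite (_ : \int[mu]_(x in D) _ = (\sum_i \int[mu]_(x in D) (h i x)%:E)%E)%E.
  by rewrite sum_fine// => i _; exact: (integrable_fin_num mD (ih i)).
rewrite -(@integral_sum _ _ _ _ _ mD _ (fun i x => (h i x)%:E))//.
by apply: eq_integral => x _; rewrite sumEFin.
Qed.

Lemma Rintegral_dist_le d (T : measurableType d) (mu : {measure set T -> \bar K})
    (D : set T) (f1 f2 : T -> K) (c : K) :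
  measurable D -> (mu D < +oo)%E ->
  mu.-integrable D (EFin \o f1) -> mu.-integrable D (EFin \o f2) ->
  (forall x, `|f1 x - f2 x| <= c) ->
  `|\int[mu]_(x in D) f1 x - \int[mu]_(x in D) f2 x| <= c * fine (mu D).
Proof.
move=> mD Doo i1 i2 f12; rewrite -RintegralB//.
have i12 : mu.-integrable D (EFin \o (fun x => f1 x - f2 x)).
  by have := integrableB mD i1 i2.
rewrite (le_trans (le_normr_Rintegral _ _))// -Rintegral_cst//.
apply: le_Rintegral => //; first exact: (integrable_abse i12).
exact: (@bounded_integrable _ _ _ mu D (cst c) `|c|).
Qed.

Lemma sum_tupleS (I : finType) n (F : n.+1.-tuple I -> K) :
  \sum_(xi : n.+1.-tuple I) F xi =
  \sum_(k : I) \sum_(xi : n.-tuple I) F [tuple of k :: xi].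
Proof.
rewrite pair_big/= (reindex (fun p : I * n.-tuple I => [tuple of p.1 :: p.2]))//=.
exists (fun t : n.+1.-tuple I => (thead t, [tuple of behead t])) => [[k xi]|t] _ /=.
  by congr pair; apply: val_inj.
by rewrite [RHS]tuple_eta.
Qed.

Definition grid n N (xi : n.-tuple 'I_N) : n.-tuple (measurableTypeR K) :=
  map_tuple (fun k : 'I_N => k%:R : K) xi.

Lemma grid_cons n N (k : 'I_N) (xi : n.-tuple 'I_N) :
  grid [tuple of k :: xi] = tcons (k%:R : measurableTypeR K, grid xi).
Proof. exact: val_inj. Qed.

(** Induction on the dimension.  The intermediate quantity I1 sums over the
    first coordinate and integrates over the others: it differs from the grid
    sum by N errors in dimension n, and from the integral by the integral of the
    one-dimensional error along the first coordinate. *)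
Lemma tensor_midpoint_rule n N (f : n.-tuple (measurableTypeR K) -> K) (c M : K) :
  (forall t i, continuous (fun x : K => f (upd t i x))) ->
  (forall t i x, f (upd t i (x + N%:R)) = f (upd t i x)) ->
  (forall t i x s, 0 <= s <= 1 ->
    `|f (upd t i (x + s)) + f (upd t i (x - s)) - 2 * f (upd t i x)| <= M) ->
  (forall t, `|f t| <= c) ->
  `|\sum_(xi : n.-tuple 'I_N) f (grid xi) - \int[lebesgue_tuple K n]_(t in cube N) f t|
    <= n%:R * N%:R ^+ n * M.
Proof.
elim: n f => [|n IH] f cf pf sf fc.
  rewrite (_ : f = cst (f [tuple])); last by apply/funext => t; rewrite tuple0.
  rewrite Rintegral_cst//; last exact: measurable_cube.
  rewrite [fine _](congr1 fine (lebesgue_tuple_cube K 0 N)) expr0 /= mulr1.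
  rewrite sumr_const card_tuple expn0.
  by rewrite subrr normr0 !mul0r.
have mf := measurable_separately_continuous cf.
have [iJ ->] := Rintegral_cube_cons N mf fc.
pose g (x : measurableTypeR K) t := f (tcons (x, t)).
have Coo : (lebesgue_tuple K n (cube N) < +oo)%E by rewrite lebesgue_tuple_cube ltry.
have mg x : measurable_fun setT (g x).
  apply: measurable_separately_continuous => t i.
  have := cf (tcons (x, t)) (lift ord0 i).
  by under [X in continuous X]eq_fun do rewrite upd_tconsS.
have ig x : (lebesgue_tuple K n).-integrable (cube N) (EFin \o g x).
  apply: (@bounded_integrable _ _ _ (lebesgue_tuple K n) _ _ c) => //.
  - exact: measurable_cube.
  - by move=> t; exact: fc.
rewrite sum_tupleS.
pose I1 := \sum_(k < N) \int[lebesgue_tuple K n]_(t in cube N) g k%:R t.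
rewrite -(subrKA I1) (le_trans (ler_normD _ _))//.
have -> : n.+1%:R * N%:R ^+ n.+1 * M =
    N%:R * (n%:R * N%:R ^+ n * M) + N%:R * M * N%:R ^+ n :> K.
  by rewrite -natr1 exprS; ring.
apply: lerD.
  rewrite /I1 -sumrB (le_trans (ler_norm_sum _ _ _))//.
  have -> : N%:R * (n%:R * N%:R ^+ n * M) =
      \sum_(k < N) (n%:R * N%:R ^+ n * M) by rewrite sumr_const card_ord mulr_natl.
  apply: ler_sum => k _.
  under eq_bigr do rewrite grid_cons.
  apply: (IH (g k%:R)) => [t i|t i x|t i x s s01|t]; last exact: fc.
  - have := cf (tcons (k%:R : measurableTypeR K, t)) (lift ord0 i).
    by under [X in continuous X]eq_fun do rewrite upd_tconsS.
  - have := pf (tcons (k%:R : measurableTypeR K, t)) (lift ord0 i) x.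
    by rewrite !upd_tconsS.
  - have := sf (tcons (k%:R : measurableTypeR K, t)) (lift ord0 i) x s s01.
    by rewrite !upd_tconsS.
have isum : (lebesgue_tuple K n).-integrable (cube N)
    (EFin \o (fun t => \sum_(k < N) g k%:R t)).
  rewrite (_ : _ \o _ = (fun t => \sum_(k < N) (EFin \o g k%:R) t)%E); last first.
    by apply/funext => t /=; rewrite sumEFin.
  apply: integrable_sum => //; exact: measurable_cube.
have -> : I1 = \int[lebesgue_tuple K n]_(t in cube N) \sum_(k < N) g k%:R t.
  by rewrite (Rintegral_sum (@measurable_cube K n N) (fun k : 'I_N => ig k%:R)).
have -> : N%:R ^+ n = fine (lebesgue_tuple K n (cube N)).
  by rewrite lebesgue_tuple_cube.
apply: Rintegral_dist_le => //; first exact: measurable_cube.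
move=> t; apply: midpoint_rule => [|x|x s s01].
- have := cf (tcons (0 : measurableTypeR K, t)) ord0.
  by under [X in continuous X]eq_fun do rewrite upd_tcons0.
- have := pf (tcons (0 : measurableTypeR K, t)) ord0 x.
  by rewrite !upd_tcons0.
- have := sf (tcons (0 : measurableTypeR K, t)) ord0 x s s01.
  by rewrite !upd_tcons0.
Qed.

End quadrature.

(** * Iterated directional derivatives and Taylor estimates *)

Section directional.
Context (K : realType).

Section matrix_domain.
Context (m n : nat) (W : normedModType K).
Implicit Types (f : 'M[K]_(m, n) -> W) (v : 'M[K]_(m, n)).

Definition derive_along (vs : seq 'M[K]_(m, n)) f : 'M[K]_(m, n) -> W :=
  foldr (fun v g => 'D_v g) f vs.

Lemma derive_along_rcons vs v f : derive_along (rcons vs v) f = derive_along vs ('D_v f).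
Proof. by rewrite /derive_along -cats1 foldr_cat. Qed.

Lemma partial_derive_along s f :
  partial s f = derive_along [seq delta_mx ij.1 ij.2 | ij <- s] f.
Proof. by rewrite /derive_along foldr_map. Qed.

Lemma Cn_derive_along k vs f : Cn (size vs + k) f -> Cn k (derive_along vs f).
Proof.
elim/last_ind: vs f => [//|vs v IH] f; rewrite size_rcons addSn derive_along_rcons.
by move=> [_ /(_ v)]; exact: IH.
Qed.

Lemma CnS k f : Cn k.+1 f -> Cn k f.
Proof.
elim: k f => [|k IH] f [df Cf]; last by split=> // v; exact: IH (Cf v).
by move=> x; apply: differentiable_continuous.
Qed.

Lemma derive_delta f v x : differentiable f x ->
  'D_v f x = \sum_i \sum_j v i j *: 'D_(delta_mx i j) f x.
Proof.
move=> df; rewrite deriveE// {1}[v]matrix_sum_delta linear_sum.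
apply: eq_bigr => i _; rewrite linear_sum; apply: eq_bigr => j _.
by rewrite linearZ/= deriveE.
Qed.

Lemma derive_sumZ (I : finType) (c : I -> K) (g : I -> 'M[K]_(m, n) -> W) v x :
  (forall i, differentiable (g i) x) ->
  'D_v (fun x => \sum_i c i *: g i x) x = \sum_i c i *: 'D_v (g i) x.
Proof.
move=> dg.
have -> : (fun x => \sum_i c i *: g i x) =
    \sum_(k < #|I|) (c (enum_val k) \*: g (enum_val k)).
  apply/funext => y; rewrite fct_sumE (reindex (@enum_val _ xpredT))//.
  by apply: onW_bij; exact: enum_val_bij.
rewrite derive_sum => [|k]; last by apply/derivableZ/diff_derivable.
rewrite [RHS](reindex (@enum_val _ xpredT))/=; last first.
  by apply: onW_bij; exact: enum_val_bij.
apply: eq_bigr => k _; rewrite deriveZ//; exact: diff_derivable.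
Qed.

(** A directional derivative is a combination of partial derivatives, and the
    derivatives taken afterwards act linearly on that combination. *)
Lemma derive_along_delta vs v f x : Cn (size vs).+1 f ->
  derive_along vs ('D_v f) x =
  \sum_(ij : 'I_m * 'I_n) v ij.1 ij.2 *: derive_along vs ('D_(delta_mx ij.1 ij.2) f) x.
Proof.
elim: vs x => [|u vs IH] x /=.
  move=> [df _]; rewrite derive_delta//.
  by rewrite (pair_bigA _ (fun i j => v i j *: 'D_(delta_mx i j) f x)).
move=> Cf; have -> : derive_along vs ('D_v f) = (fun x =>
   \sum_(ij : 'I_m * 'I_n) v ij.1 ij.2 *: derive_along vs ('D_(delta_mx ij.1 ij.2) f) x).
  apply/funext => y; apply: IH; exact: CnS.
rewrite derive_sumZ// => ij.
have : Cn (size vs + 1) ('D_(delta_mx ij.1 ij.2) f) by rewrite addn1; exact: Cf.2.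
by move/Cn_derive_along => -[].
Qed.

(** Expanding the innermost direction first keeps the remaining iterated
    derivative in the same form; each expansion has m * n terms. *)
Lemma norm_derive_along_le vs f x (b : K) :
  Cn (size vs) f ->
  (forall s : (size vs).-tuple ('I_m * 'I_n), `|partial s f x| <= b) ->
  `|derive_along vs f x| <= \prod_(v <- vs) ((m * n)%:R * `|v|) * b.
Proof.
elim/last_ind: vs f => [|vs v IH] f.
  by move=> _ /(_ [tuple])/=; rewrite big_nil mul1r.
rewrite derive_along_rcons size_rcons => Cf fb; rewrite derive_along_delta//.
rewrite -cats1 big_cat/= big_seq1 (le_trans (ler_norm_sum _ _ _))//.
pose c := \prod_(v <- vs) ((m * n)%:R * `|v|).
rewrite (@le_trans _ _ (\sum_(ij : 'I_m * 'I_n) `|v| * (c * b)))//; last first.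
  rewrite sumr_const card_prod !card_ord -[leLHS]mulr_natl -/c.
  by rewrite le_eqVlt; apply/orP; left; apply/eqP; ring.
apply: ler_sum => ij _; rewrite normrZ ler_pM//.
  by rewrite [leRHS]/Num.Def.normr/= mx_normrE; exact: le_bigmax.
apply: IH => [|s]; first exact: Cf.2.
have := fb [tuple of rcons s ij].
by rewrite !partial_derive_along/= map_rcons derive_along_rcons.
Qed.

End matrix_domain.

Section taylor.
Context (U : normedModType K) (v : U).

Lemma is_derive_path (f f1 : U -> K) x (t : K) :
  (forall x, is_derive x v f (f1 x)) ->
  is_derive t 1 (fun s : K => f (x + s *: v)) (f1 (x + t *: v)).
Proof. by move=> df; apply: is_derive_line. Qed.

(** The remainder bounds below omit the factorials: a remainder whose
    derivative is at most M on [0, 1] is at most M, and each order is obtained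
    from the preceding one applied to the derivative. *)
Lemma taylor1 (f f1 : U -> K) (M t : K) x : 0 <= t <= 1 ->
  (forall x, is_derive x v f (f1 x)) -> (forall x, `|f1 x| <= M) ->
  `|f (x + t *: v) - f x| <= M.
Proof.
move=> /andP[t0 t1] df fM.
have := @mean_value_le _ (fun s => f (x + s *: v)) _ 0 t M t0
  (fun s _ => is_derive_path x s df) (fun s _ => fM _).
rewrite scale0r addr0 subr0 => /le_trans; apply.
by rewrite ler_piMr// (le_trans _ (fM x)).
Qed.

Lemma taylor2 (f f1 f2 : U -> K) (M t : K) x : 0 <= t <= 1 ->
  (forall x, is_derive x v f (f1 x)) -> (forall x, is_derive x v f1 (f2 x)) ->
  (forall x, `|f2 x| <= M) ->
  `|f (x + t *: v) - f x - t * f1 x| <= M.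
Proof.
move=> /andP[t0 t1] df df1 fM.
pose phi s := f (x + s *: v) - s * f1 x.
have dphi (s : K) : is_derive s 1 phi (f1 (x + s *: v) - f1 x).
  apply: is_deriveB; first exact: is_derive_path.
  have := is_deriveM (is_derive_id s 1) (is_derive_cst (f1 x) s 1).
  by rewrite scaler0 add0r [_ *: 1]mulr1.
have := @mean_value_le _ phi _ 0 t M t0 (fun s _ => dphi s).
have -> : phi t - phi 0 = f (x + t *: v) - f x - t * f1 x.
  by rewrite /phi scale0r addr0 mul0r subr0; ring.
rewrite subr0 => /(_ _)/le_trans; apply.
  move=> s /andP[s0 st]; apply: (taylor1 _ _ df1 fM); rewrite s0/=.
  exact: le_trans st t1.
by rewrite ler_piMr// (le_trans _ (fM x)).
Qed.

Lemma taylor3 (f f1 f2 f3 : U -> K) (M t : K) x : 0 <= t <= 1 ->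
  (forall x, is_derive x v f (f1 x)) -> (forall x, is_derive x v f1 (f2 x)) ->
  (forall x, is_derive x v f2 (f3 x)) -> (forall x, `|f3 x| <= M) ->
  `|f (x + t *: v) - f x - t * f1 x - t ^+ 2 / 2 * f2 x| <= M.
Proof.
move=> /andP[t0 t1] df df1 df2 fM.
pose phi s := f (x + s *: v) - s * f1 x - s ^+ 2 * (f2 x / 2).
have dphi (s : K) : is_derive s 1 phi (f1 (x + s *: v) - f1 x - s * f2 x).
  apply: is_deriveB.
    apply: is_deriveB; first exact: is_derive_path.
    have := is_deriveM (is_derive_id s 1) (is_derive_cst (f1 x) s 1).
    by rewrite scaler0 add0r [_ *: 1]mulr1.
  have := is_deriveM (is_deriveX 2 (is_derive_id s 1)) (is_derive_cst (f2 x / 2) s 1).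
  rewrite scaler0 add0r [(_ * _) *: 1]mulr1 expr1.
  by rewrite /GRing.scale/= (_ : f2 x / 2 * (2 * s) = s * f2 x)//; field.
have := @mean_value_le _ phi _ 0 t M t0 (fun s _ => dphi s).
have -> : phi t - phi 0 = f (x + t *: v) - f x - t * f1 x - t ^+ 2 / 2 * f2 x.
  by rewrite /phi scale0r addr0 mul0r expr0n/= mul0r !subr0; ring.
rewrite subr0 => /(_ _)/le_trans; apply.
  move=> s /andP[s0 st]; apply: (taylor2 _ _ df1 df2 fM); rewrite s0/=.
  exact: le_trans st t1.
by rewrite ler_piMr// (le_trans _ (fM x)).
Qed.

End taylor.
End directional.

(** * Matrix-valued functions and second differences of a potential *)

Section matrix_valued.
Context (K : realType).

Lemma mx_norm_le p q (A : 'M[K]_(p, q)) (M : K) : 0 <= M ->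
  (forall i j, `|A i j| <= M) -> `|A| <= M.
Proof.
move=> M0 AM; rewrite /Num.Def.normr/= mx_normrE.
by apply: bigmax_le => // -[i j] _; exact: AM.
Qed.

Lemma coord_norm_le p q (A : 'M[K]_(p, q)) i j : `|A i j| <= `|A|.
Proof.
rewrite [leRHS]/Num.Def.normr/= mx_normrE.
exact: (le_bigmax _ (fun ij => `|A ij.1 ij.2|) (i, j)).
Qed.

Section codomain.
Context (U : normedModType K) (v : U) (p q : nat).
Implicit Types f : U -> 'M[K]_(p, q).

Lemma is_derive_coord f x l i j :
  is_derive x v f l -> is_derive x v (fun y => f y i j) (l i j).
Proof.
case=> df <-; split; first exact: (derivable_mxP _ _ _).1 df i j.
by rewrite derive_mx// mxE.
Qed.

Lemma taylor2_mx f f1 f2 M x :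
  (forall x, is_derive x v f (f1 x)) -> (forall x, is_derive x v f1 (f2 x)) ->
  (forall x, `|f2 x| <= M) ->
  `|f (x + v) - f x - f1 x| <= M.
Proof.
move=> df df1 fM; have M0 := le_trans (normr_ge0 _) (fM x).
apply: mx_norm_le => // i j; rewrite !mxE -[v]scale1r -[f1 x i j]mul1r.
apply: (@taylor2 _ _ v (fun y => f y i j) (fun y => f1 y i j) (fun y => f2 y i j)).
- by rewrite ler01 lexx.
- by move=> y; exact: is_derive_coord.
- by move=> y; exact: is_derive_coord.
- by move=> y; exact: le_trans (coord_norm_le _ _ _) (fM y).
Qed.

Lemma taylor3_mx f f1 f2 f3 M x :
  (forall x, is_derive x v f (f1 x)) -> (forall x, is_derive x v f1 (f2 x)) ->
  (forall x, is_derive x v f2 (f3 x)) -> (forall x, `|f3 x| <= M) ->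
  `|f (x + v) - f x - f1 x - 2^-1 *: f2 x| <= M.
Proof.
move=> df df1 df2 fM; have M0 := le_trans (normr_ge0 _) (fM x).
apply: mx_norm_le => // i j; rewrite !mxE -[v]scale1r -[f1 x i j]mul1r.
rewrite (_ : 2^-1 = 1 ^+ 2 / 2); last by rewrite expr1n mul1r.
apply: (@taylor3 _ _ v (fun y => f y i j) (fun y => f1 y i j)
  (fun y => f2 y i j) (fun y => f3 y i j)).
- by rewrite ler01 lexx.
- by move=> y; exact: is_derive_coord.
- by move=> y; exact: is_derive_coord.
- by move=> y; exact: is_derive_coord.
- by move=> y; exact: le_trans (coord_norm_le _ _ _) (fM y).
Qed.

End codomain.

Section partial_bounds.
Context (m n : nat) (W : normedModType K).
Implicit Types f : 'M[K]_(m, n) -> W.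

Definition nabla_le k f (b : K) := forall x, nabla_norm k f x <= b.

Lemma nabla_le_ge0 k f b : nabla_le k f b -> 0 <= b.
Proof. by move=> /(_ 0); apply: le_trans; exact: bigmax_ge_id. Qed.

Lemma nabla_sup_ge0 k f : (0 <= nabla_sup k f)%E.
Proof.
apply: (@le_trans _ _ (nabla_norm k f 0)%:E).
  by rewrite lee_fin /nabla_norm; exact: bigmax_ge_id.
by apply: ereal_sup_ubound; exists 0.
Qed.

Lemma nabla_le_sup k f : nabla_sup k f \is a fin_num ->
  nabla_le k f (fine (nabla_sup k f)).
Proof.
by move=> ff x; rewrite -lee_fin fineK//; apply: ereal_sup_ubound; exists x.
Qed.

Lemma is_derive_Cn k f v x : Cn k.+1 f -> is_derive x v f ('D_v f x).
Proof. by move=> [df _]; apply: DeriveDef => //; exact: diff_derivable. Qed.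

Lemma norm_derive_along_nabla vs f (b : K) x : Cn (size vs) f -> nabla_le (size vs) f b ->
  `|derive_along vs f x| <= \prod_(v <- vs) ((m * n)%:R * `|v|) * b.
Proof.
move=> Cf fb; apply: norm_derive_along_le => // s; apply: le_trans (fb x).
exact: (le_bigmax _ (fun s : (size vs).-tuple _ => `|partial s f x|) s).
Qed.

Lemma norm_derive1_le f u x (a b : K) : Cn 1 f -> nabla_le 1 f b ->
  (m * n)%:R * `|u| <= a -> `|'D_u f x| <= a * b.
Proof.
move=> Cf fb ua; apply: le_trans (@norm_derive_along_nabla [:: u] f b x Cf fb) _.
by rewrite big_seq1 ler_wpM2r// (nabla_le_ge0 fb).
Qed.

Lemma norm_derive2_le f u v x (a a' b : K) : Cn 2 f -> nabla_le 2 f b ->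
  (m * n)%:R * `|u| <= a -> (m * n)%:R * `|v| <= a' ->
  `|'D_u ('D_v f) x| <= a * a' * b.
Proof.
move=> Cf fb ua va; apply: le_trans (@norm_derive_along_nabla [:: u; v] f b x Cf fb) _.
rewrite big_cons big_seq1 ler_wpM2r ?(nabla_le_ge0 fb)//.
by rewrite ler_pM// mulr_ge0.
Qed.

Lemma norm_derive3_le f u v w x (a a' a'' b : K) : Cn 3 f -> nabla_le 3 f b ->
  (m * n)%:R * `|u| <= a -> (m * n)%:R * `|v| <= a' -> (m * n)%:R * `|w| <= a'' ->
  `|'D_u ('D_v ('D_w f)) x| <= a * (a' * a'') * b.
Proof.
move=> Cf fb ua va wa.
apply: le_trans (@norm_derive_along_nabla [:: u; v; w] f b x Cf fb) _.
rewrite !big_cons big_nil mulr1 ler_wpM2r ?(nabla_le_ge0 fb)//.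
by rewrite !ler_pM ?mulr_ge0.
Qed.

End partial_bounds.

Section potential.
Context (p q : nat) (V : 'M[K]_(p, q) -> K) (L : K).
Hypotheses (CV : Cn 2 V) (V1 : nabla_le 1 V L) (V2 : nabla_le 2 V L).
Let Q : K := (p * q)%:R.

Lemma potential_lipschitz G r : `|V (G + r) - V G| <= Q * `|r| * L.
Proof.
rewrite -[r in G + r]scale1r.
apply: (@taylor1 _ _ r V ('D_r V)) => [|x|x]; first by rewrite ler01 lexx.
  exact: (@is_derive_Cn _ _ _ 0 V r x (CnS CV)).
by apply: norm_derive1_le => //; exact: CnS.
Qed.

(** The linear terms of the two Taylor expansions at G cancel, hence the
    square of the norm of e; the perturbations r1 and r2 enter through the Lipschitz
    bound. *)
Lemma potential_second_difference G G1 G2 e r1 r2 :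
  G1 = G + e + r1 -> G2 = G - e + r2 ->
  `|V G1 + V G2 - 2 * V G| <= L * (2 * (Q * `|e|) ^+ 2 + Q * `|r1| + Q * `|r2|).
Proof.
move=> -> ->.
have h1 := potential_lipschitz (G + e) r1.
have h2 := potential_lipschitz (G - e) r2.
have tay v : `|V (G + v) - V G - 'D_v V G| <= (Q * `|v|) * (Q * `|v|) * L.
  rewrite -[v in G + v]scale1r -['D_v V G]mul1r.
  apply: (@taylor2 _ _ v V ('D_v V) ('D_v ('D_v V))) => [|x|x|x].
  - by rewrite ler01 lexx.
  - exact: (@is_derive_Cn _ _ _ 1 V v x CV).
  - exact: (@is_derive_Cn _ _ _ 0 _ v x (CV.2 v)).
  - exact: norm_derive2_le.
have h3 := tay e; have := tay (- e).
have -> : 'D_(- e) V G = - 'D_e V G.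
  by have [dV _] := CV; rewrite !deriveE// linearN.
rewrite normrN => h4.
have -> : V (G + e + r1) + V (G - e + r2) - 2 * V G =
  (V (G + e + r1) - V (G + e)) + (V (G - e + r2) - V (G - e)) +
  ((V (G + e) - V G - 'D_e V G) + (V (G - e) - V G - - 'D_e V G)) by ring.
apply: le_trans (ler_normD _ _) _.
have := ler_normD (V (G + e + r1) - V (G + e)) (V (G - e + r2) - V (G - e)).
have := ler_normD (V (G + e) - V G - 'D_e V G) (V (G - e) - V G - - 'D_e V G).
move: h1 h2 h3 h4; lra.
Qed.

End potential.
End matrix_valued.

(** * Continuum and discrete strains *)

Lemma deriveNv (K : realType) (U W : normedModType K) (f : U -> W) v x :
  differentiable f x -> 'D_(- v) f x = - 'D_v f x.
Proof. by move=> df; rewrite !deriveE// linearN. Qed.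

Lemma add_remainder (W : zmodType) (a b c : W) : a = b + c + (a - b - c).
Proof. by rewrite -(addrA a) -opprD [RHS]addrC subrK. Qed.

Section stencils.
Context (K : realType) (d : nat) (R : {fset bond d}).
Implicit Types g : bond d -> 'cV[K]_d.

Lemma stencilD g1 g2 : stencil R (fun r => g1 r + g2 r) = stencil R g1 + stencil R g2.
Proof. by apply/matrixP => i j; rewrite !mxE. Qed.

Lemma stencilN g : stencil R (fun r => - g r) = - stencil R g.
Proof. by apply/matrixP => i j; rewrite !mxE. Qed.

Lemma eq_stencil g1 g2 : {in R, g1 =1 g2} -> stencil R g1 = stencil R g2.
Proof.
move=> gE; apply/matrixP => i j; rewrite !mxE gE//.
exact: (mem_tnth j (in_tuple R)).
Qed.

Lemma stencil_norm_le g (M : K) : 0 <= M -> (forall r, r \in R -> `|g r| <= M) ->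
  `|stencil R g| <= M.
Proof.
move=> M0 gM; apply: mx_norm_le => // i j; rewrite mxE.
apply: le_trans (coord_norm_le _ _ _) (gM _ _).
exact: (mem_tnth j (in_tuple R)).
Qed.

End stencils.

Section fields.
Context (K : realType) (d : nat).
Implicit Types (Y P f : 'cV[K]_d -> 'cV[K]_d) (r : bond d) (rho : 'cV[int]_d).

(** The strain of the rescaled fields at x / h, in terms of the fields
    themselves at x, where h is the inverse of the scaling factor. *)
Definition scaled_strain (h : K) Y P r (x : 'cV[K]_d) : 'cV[K]_d :=
  let: (rho, a, b) := r in
  'D_(zvec K rho) Y x + (b%:R - a%:R) *: P x
  + (h * ((a%:R + b%:R) / 2)) *: 'D_(zvec K rho) P x.

(** The finite difference of the atomistic deformation along a bond, in the
    same unscaled variables. *)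
Definition discrete_strain (h : K) Y P r (x : 'cV[K]_d) : 'cV[K]_d :=
  let: (rho, a, b) := r in
  h^-1 *: (Y (x + h *: zvec K rho) - Y x) + b%:R *: P (x + h *: zvec K rho)
  - a%:R *: P x.

Lemma zvecD rho rho' : zvec K (rho + rho') = zvec K rho + zvec K rho'.
Proof. by apply/matrixP => i j; rewrite !mxE intrD. Qed.

Lemma zvecN rho : zvec K (- rho) = - zvec K rho.
Proof. by apply/matrixP => i j; rewrite !mxE rmorphN. Qed.

Lemma derive_rescale (W : normedModType K) (f : 'cV[K]_d -> W) (c h : K) v x :
  differentiable f (h *: x) ->
  'D_v (fun z => c *: f (h *: z)) x = (c * h) *: 'D_v f (h *: x).
Proof.
move=> df.
have : is_derive (h *: x + (0 : K) *: (h *: v)) (h *: v) f (h *: 'D_v f (h *: x)).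
  rewrite scale0r addr0; apply: DeriveDef; first exact: diff_derivable.
  by rewrite deriveE// linearZ/= -deriveE.
move=> /is_derive_line H.
have : is_derive x v (fun z => c *: f (h *: z)) ((c * h) *: 'D_v f (h *: x)).
  rewrite -[x in is_derive x]addr0 -(scale0r v); apply/is_derive_lineP.
  rewrite -scalerA; have := is_deriveZ c H.
  congr is_derive; apply/funext => s /=.
  by rewrite scalerDr !scalerA [h * s]mulrC.
by case.
Qed.

Lemma cdiff_rescale N Y P r x : (0 < N)%N -> Cn 1 Y -> Cn 1 P ->
  cdiff (rescale_deformation N Y) (rescale_shift N P) x r =
  scaled_strain N%:R^-1 Y P r (N%:R^-1 *: x).
Proof.
move=> N0 [dY _] [dP _]; case: r => [[rho a] b] /=.
have N1 : N%:R != 0 :> K by rewrite pnatr_eq0 -lt0n.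
have -> : 'D_(zvec K rho) (rescale_deformation N Y) x =
    'D_(zvec K rho) Y (N%:R^-1 *: x).
  rewrite (@derive_rescale _ Y N%:R N%:R^-1 (zvec K rho) x (dY _)).
  by rewrite mulfV// scale1r.
have -> : 'D_(zvec K rho) (rescale_shift N P) x =
    N%:R^-1 *: 'D_(zvec K rho) P (N%:R^-1 *: x).
  have -> : rescale_shift N P = (fun z => 1 *: P (N%:R^-1 *: z)).
    by apply/funext => z; rewrite scale1r.
  by rewrite (@derive_rescale _ P 1 N%:R^-1 (zvec K rho) x (dP _)) mul1r.
by rewrite scalerA [_ * N%:R^-1]mulrC.
Qed.

Lemma fdiff_atomistic N Y P r xi : (0 < N)%N ->
  fdiff (atomistic (rescale_deformation N Y) (rescale_shift N P)) xi r =
  discrete_strain N%:R^-1 Y P r (N%:R^-1 *: zvec K xi).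
Proof.
move=> N0; case: r => [[rho a] b].
rewrite /fdiff /atomistic /rescale_deformation /rescale_shift /discrete_strain.
rewrite zvecD scalerDr invrK scalerBr.
case: a; case: b; rewrite ?scale1r ?scale0r ?addr0 ?subr0 //.
- by rewrite opprD addrA; congr (_ - _); rewrite addrAC.
- by rewrite opprD addrA.
- by rewrite addrAC.
Qed.

(** The sum (a + b) / 2 is symmetric in the two species and the difference
    b - a is antisymmetric, so each of the three terms changes sign. *)
Lemma scaled_strain_flip h Y P r x : Cn 1 Y -> Cn 1 P ->
  scaled_strain h Y P (flip r) x = - scaled_strain h Y P r x.
Proof.
move=> [dY _] [dP _]; case: r => [[rho a] b] /=.
rewrite zvecN !deriveNv// !opprD -scaleNr opprB -scalerN.
by congr (_ + _ + _ *: _); rewrite [a%:R + _]addrC.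
Qed.

End fields.

(** * Arithmetic of the constants *)

Lemma bounded_second_difference (K : realType) (a b g L M : K) :
  `|a| <= L -> `|b| <= L -> `|g| <= L -> L <= M -> `|a + b - 2 * g| <= 8 * M.
Proof.
move=> aL bL gL LM; have := ler_normB (a + b) (2 * g); have := ler_normD a b.
by rewrite normrM (gtr0_norm (ltr0n K 2)); move: (normr_ge0 a); lra.
Qed.

Section constants.
Context (K : realType) (Q k h y2 y3 p1 p2 p3 L : K).
Hypotheses (Q0 : 0 <= Q) (k1 : 1 <= k) (h0 : 0 <= h) (L0 : 0 <= L).
Hypotheses (y20 : 0 <= y2) (y30 : 0 <= y3) (p10 : 0 <= p1).
Hypotheses (p20 : 0 <= p2) (p30 : 0 <= p3).

Let W : K := (Q + 1) ^+ 2 * k ^+ 4.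
Let T : K := y3 + p3 + p2 + y2 ^+ 2 + p1 ^+ 2.

Let k0 : 0 <= k. Proof. exact: le_trans k1. Qed.

Lemma weight_ge1 : 1 <= W.
Proof.
rewrite /W -[leLHS]mulr1 ler_pM//; last by rewrite exprn_ege1.
by rewrite exprn_ege1// lerDr.
Qed.

Let W0 : 0 <= W. Proof. exact: le_trans weight_ge1. Qed.
Let k12 : k <= k ^+ 2. Proof. by rewrite expr2 ler_peMl. Qed.
Let k23 : k ^+ 2 <= k ^+ 3. Proof. by rewrite [leRHS]exprS ler_peMl// exprn_ge0. Qed.
Let k34 : k ^+ 3 <= k ^+ 4. Proof. by rewrite [leRHS]exprS ler_peMl// exprn_ge0. Qed.

(** The factor W of the final constant absorbs the number Q of entries of a
    stencil and all powers of the range k up to the fourth. *)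
Lemma square_weight (u v : K) : 0 <= u -> 0 <= v -> v <= k ^+ 2 * u ->
  (Q * v) ^+ 2 <= W * u ^+ 2.
Proof.
move=> u0 v0 vu; have -> : W * u ^+ 2 = ((Q + 1) * (k ^+ 2 * u)) ^+ 2.
  by rewrite /W; ring.
have Q1 : Q <= Q + 1 by rewrite lerDl.
by rewrite !expr2; apply: ler_pM; rewrite ?mulr_ge0//; apply: ler_pM.
Qed.

Lemma linear_weight (u v : K) : 0 <= u -> 0 <= v -> v <= k ^+ 3 * u ->
  Q * v <= W * u.
Proof.
move=> u0 v0 vu; rewrite /W -mulrA; apply: ler_pM => //.
  by rewrite sqrrD1; move: Q0 (sqr_ge0 Q); lra.
by apply: le_trans vu _; rewrite ler_wpM2r.
Qed.

Lemma site_constant :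
  L * ((Q * (h * (k * k * y2 + k * p1))) ^+ 2
       + Q * (h ^+ 2 * (k * (k * k) * y3 + k * k * p2))) <=
  2 * L * W * h ^+ 2 * T.
Proof.
have sq := @square_weight (h * (y2 + p1)) (h * (k * k * y2 + k * p1)).
have li := @linear_weight (h ^+ 2 * (y3 + p2))
  (h ^+ 2 * (k * (k * k) * y3 + k * k * p2)).
have hsq : 0 <= h ^+ 2 by rewrite sqr_ge0.
have {}sq : (Q * (h * (k * k * y2 + k * p1))) ^+ 2 <= W * (h * (y2 + p1)) ^+ 2.
  apply: sq; rewrite ?mulr_ge0 ?addr_ge0 ?mulr_ge0//.
  by have := ler_wpM2r (mulr_ge0 h0 p10) k12; rewrite !mulrDr; lra.
have {}li : Q * (h ^+ 2 * (k * (k * k) * y3 + k * k * p2)) <=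
    W * (h ^+ 2 * (y3 + p2)).
  apply: li; rewrite ?mulr_ge0 ?addr_ge0 ?mulr_ge0//.
  by have := ler_wpM2r (mulr_ge0 hsq p20) k23; rewrite !mulrDr; lra.
have sq' : (h * (y2 + p1)) ^+ 2 <= h ^+ 2 * (2 * (y2 ^+ 2 + p1 ^+ 2)).
  by rewrite exprMn ler_wpM2l//; have := sqr_ge0 (y2 - p1); lra.
have {}sq := le_trans sq (ler_wpM2l W0 sq').
have -> : 2 * L * W * h ^+ 2 * T = L * (W * (h ^+ 2 * (2 * T))) by ring.
rewrite ler_wpM2l//.
have : W * (h ^+ 2 * (2 * (y2 ^+ 2 + p1 ^+ 2) + (y3 + p2)))
   <= W * (h ^+ 2 * (2 * T)).
  by rewrite !ler_wpM2l// /T; move: y30 p20 p30; lra.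
by move: sq li; rewrite !mulrDr; lra.
Qed.

(** The hypothesis on h ^+ 2 * p2 is what makes the square of h * p2 at most
    p2. *)
Lemma step_constant : h <= 1 -> h ^+ 2 * p2 <= 1 ->
  L * (2 * (Q * (k * h * k * y2 + k * h * p1 + h * (k * h * k * p2))) ^+ 2
       + 2 * (Q * (k * h * (k * h * k) * y3 + k * h * (k * h) * p2
                   + h * (k * h * (k * h * k) * p3)))) <=
  8 * L * W * h ^+ 2 * T.
Proof.
move=> h1 hp2.
have hsq : 0 <= h ^+ 2 by rewrite sqr_ge0.
have sq : (Q * (k * h * k * y2 + k * h * p1 + h * (k * h * k * p2))) ^+ 2 <=
    W * (h * (y2 + p1 + h * p2)) ^+ 2.
  apply: square_weight; rewrite ?mulr_ge0 ?addr_ge0 ?mulr_ge0//.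
  have := ler_wpM2r (mulr_ge0 h0 p10) k12.
  by rewrite !mulrDr; lra.
have li : Q * (k * h * (k * h * k) * y3 + k * h * (k * h) * p2
                   + h * (k * h * (k * h * k) * p3)) <=
    W * (h ^+ 2 * (y3 + p2 + p3)).
  apply: linear_weight; rewrite ?mulr_ge0 ?addr_ge0 ?mulr_ge0//.
  have := ler_wpM2r (mulr_ge0 hsq p20) k23.
  have := ler_wpM2r (mulr_ge0 hsq (mulr_ge0 p30 (exprn_ge0 3 k0))) h1.
  by rewrite !mulrDr; lra.
have sq' : (h * (y2 + p1 + h * p2)) ^+ 2 <= h ^+ 2 * (3 * (y2 ^+ 2 + p1 ^+ 2 + p2)).
  rewrite exprMn ler_wpM2l//.
  have := ler_wpM2r p20 hp2.
  have := sqr_ge0 (y2 - p1); have := sqr_ge0 (y2 - h * p2).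
  have := sqr_ge0 (p1 - h * p2); lra.
have {}sq := le_trans sq (ler_wpM2l W0 sq').
have -> : 8 * L * W * h ^+ 2 * T = L * (W * (h ^+ 2 * (8 * T))) by ring.
rewrite ler_wpM2l//.
have : W * (h ^+ 2 * (6 * (y2 ^+ 2 + p1 ^+ 2 + p2) + 2 * (y3 + p2 + p3)))
   <= W * (h ^+ 2 * (8 * T)).
  rewrite !ler_wpM2l// /T; move: (sqr_ge0 y2) (sqr_ge0 p1) y30 p20 p30; lra.
by move: sq li; rewrite !mulrDr; lra.
Qed.

End constants.

(** * Errors at a grid point *)

Section estimates.
Context (K : realType) (d : nat) (R : {fset bond d}).
Context (V : 'M[K]_(d, #|` R|) -> K) (Y P : 'cV[K]_d -> 'cV[K]_d).
Context (L y2 y3 p1 p2 p3 h kappa : K).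
Hypotheses (CV : Cn 2 V) (V1 : nabla_le 1 V L) (V2 : nabla_le 2 V L).
Hypotheses (CY : Cn 3 Y) (CP : Cn 3 P).
Hypotheses (Y2 : nabla_le 2 Y y2) (Y3 : nabla_le 3 Y y3).
Hypotheses (P1 : nabla_le 1 P p1) (P2 : nabla_le 2 P p2) (P3 : nabla_le 3 P p3).
Hypotheses (h0 : 0 < h).
(* 'cV[K]_d has d * 1 entries, and kappa absorbs this number of terms of a
   directional derivative together with the length of the direction. *)
Hypothesis kappaR : forall r, r \in R -> (d * 1)%:R * `|zvec K r.1.1| <= kappa.
Hypothesis kappa1 : 1 <= kappa.

Let Q : K := (d * #|` R|)%:R.
Let F r x := scaled_strain h Y P r x.

Let Q0 : 0 <= Q. Proof. exact: ler0n. Qed.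
Let kappa0 : 0 <= kappa. Proof. exact: le_trans kappa1. Qed.
Let y2_0 : 0 <= y2. Proof. exact: nabla_le_ge0 Y2. Qed.
Let y3_0 : 0 <= y3. Proof. exact: nabla_le_ge0 Y3. Qed.
Let p1_0 : 0 <= p1. Proof. exact: nabla_le_ge0 P1. Qed.
Let p2_0 : 0 <= p2. Proof. exact: nabla_le_ge0 P2. Qed.
Let p3_0 : 0 <= p3. Proof. exact: nabla_le_ge0 P3. Qed.
Let L_0 : 0 <= L. Proof. exact: nabla_le_ge0 V1. Qed.

Lemma bool_diff_le1 (a b : bool) : `|b%:R - a%:R| <= 1 :> K.
Proof. by case: a; case: b; rewrite ?subrr ?subr0 ?sub0r ?normrN ?normr1 ?normr0. Qed.

Lemma bool_half_diff_le1 (a b : bool) : `|(b%:R - a%:R) / 2| <= 1 :> K.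
Proof. by rewrite ler_norml; case: a; case: b => /=; lra. Qed.

Lemma bool_mean_le1 (a b : bool) : `|(a%:R + b%:R) / 2| <= 1 :> K.
Proof. by case: a; case: b => /=; rewrite ger0_norm; lra. Qed.

Lemma norm_scale2 (u w : 'cV[K]_d) (s t A B c : K) : `|s| <= c -> `|t| <= c ->
  `|u| <= A -> `|w| <= B -> `|s *: u + t *: w| <= c * (A + B).
Proof.
move=> sc tc uA wB; apply: le_trans (ler_normD _ _) _; rewrite mulrDr.
by apply: lerD; rewrite normrZ ler_pM.
Qed.

Lemma norm_combination (u v w : 'cV[K]_d) (a b : bool) (A B C c : K) : 0 <= c ->
  `|u| <= A -> `|v| <= B -> `|w| <= C ->
  `|u + (b%:R - a%:R) *: v + (c * ((a%:R + b%:R) / 2)) *: w| <= A + B + c * C.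
Proof.
move=> c0 uA vB wC; apply: le_trans (ler_normD _ _) _; apply: lerD.
  apply: le_trans (ler_normD _ _) _; apply: lerD => //.
  rewrite normrZ -[B]mul1r ler_pM//; exact: bool_diff_le1.
rewrite normrZ normrM (ger0_norm c0) -mulrA ler_wpM2l//.
by rewrite -[C]mul1r ler_pM//; exact: bool_mean_le1.
Qed.

Definition strain_derivative (u : 'cV[K]_d) (r : bond d) x : 'cV[K]_d :=
  let: (rho, a, b) := r in
  'D_u ('D_(zvec K rho) Y) x + (b%:R - a%:R) *: 'D_u P x
  + (h * ((a%:R + b%:R) / 2)) *: 'D_u ('D_(zvec K rho) P) x.

Definition strain_derivative2 (u : 'cV[K]_d) (r : bond d) x : 'cV[K]_d :=
  let: (rho, a, b) := r in
  'D_u ('D_u ('D_(zvec K rho) Y)) x + (b%:R - a%:R) *: 'D_u ('D_u P) x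
  + (h * ((a%:R + b%:R) / 2)) *: 'D_u ('D_u ('D_(zvec K rho) P)) x.

Lemma is_derive_strain u r x : is_derive x u (F r) (strain_derivative u r x).
Proof.
case: r => [[rho a] b]; apply: is_deriveD; first apply: is_deriveD.
- exact: (@is_derive_Cn _ _ _ _ 1 _ u x (CY.2 (zvec K rho))).
- exact: (is_deriveZ _ (@is_derive_Cn _ _ _ _ 2 _ u x CP)).
- exact: (is_deriveZ _ (@is_derive_Cn _ _ _ _ 1 _ u x (CP.2 (zvec K rho)))).
Qed.

Lemma is_derive_strain2 u r x :
  is_derive x u (strain_derivative u r) (strain_derivative2 u r x).
Proof.
case: r => [[rho a] b]; apply: is_deriveD; first apply: is_deriveD.
- exact: (@is_derive_Cn _ _ _ _ 0 _ u x ((CY.2 (zvec K rho)).2 u)).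
- exact: (is_deriveZ _ (@is_derive_Cn _ _ _ _ 1 _ u x (CP.2 u))).
- exact: (is_deriveZ _ (@is_derive_Cn _ _ _ _ 0 _ u x ((CP.2 (zvec K rho)).2 u))).
Qed.

Lemma strain_derivative_le u r x (eta : K) : r \in R ->
  (d * 1)%:R * `|u| <= eta ->
  `|strain_derivative u r x| <= eta * kappa * y2 + eta * p1 + h * (eta * kappa * p2).
Proof.
move=> /kappaR; case: r => [[rho a] b] /= rk ue; apply: norm_combination.
- exact: ltW.
- by apply: norm_derive2_le => //; exact: CnS.
- by apply: norm_derive1_le => //; do 2 apply: CnS.
- by apply: norm_derive2_le => //; exact: CnS.
Qed.

Lemma strain_derivative2_le u r x (eta : K) : r \in R ->
  (d * 1)%:R * `|u| <= eta ->
  `|strain_derivative2 u r x| <= eta * (eta * kappa) * y3 + eta * eta * p2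
     + h * (eta * (eta * kappa) * p3).
Proof.
move=> /kappaR; case: r => [[rho a] b] /= rk ue; apply: norm_combination.
- exact: ltW.
- exact: norm_derive3_le.
- by apply: norm_derive2_le => //; exact: CnS.
- exact: norm_derive3_le.
Qed.

(** Taylor expansion of the strains at x in directions u and - u gives
    opposite first-order terms, so this is a second difference of V up to
    second-order remainders. *)
Lemma energy_density_second_difference u x (eta : K) : (d * 1)%:R * `|u| <= eta ->
  `|V (stencil R (F ^~ (x + u))) + V (stencil R (F ^~ (x - u)))
     - 2 * V (stencil R (F ^~ x))| <=
  L * (2 * (Q * (eta * kappa * y2 + eta * p1 + h * (eta * kappa * p2))) ^+ 2
       + 2 * (Q * (eta * (eta * kappa) * y3 + eta * eta * p2
                   + h * (eta * (eta * kappa) * p3)))).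
Proof.
move=> ue.
have e0 : 0 <= eta by apply: le_trans ue; rewrite mulr_ge0.
set E1 := _ + h * _; set E2 := _ + h * (eta * (_ * _) * _).
have E1_0 : 0 <= E1 by rewrite /E1 !addr_ge0 ?mulr_ge0 ?(ltW h0).
have E2_0 : 0 <= E2 by rewrite /E2 !addr_ge0 ?mulr_ge0 ?(ltW h0).
pose e := stencil R (fun r => strain_derivative u r x).
pose rem v := stencil R (fun r => F r (x + v) - F r x - strain_derivative v r x).
have remE v : (d * 1)%:R * `|v| <= eta -> `|rem v| <= E2.
  move=> ve; apply: stencil_norm_le => // r rR.
  exact: (@taylor2_mx _ _ v _ _ (F r) (strain_derivative v r) (strain_derivative2 v r)
    E2 x (is_derive_strain v r) (is_derive_strain2 v r)
    (fun y => strain_derivative2_le y rR ve)).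
have eE : `|e| <= E1 by apply: stencil_norm_le => // r rR; exact: strain_derivative_le.
have FE v : stencil R (F ^~ (x + v)) =
    stencil R (F ^~ x) + stencil R (fun r => strain_derivative v r x) + rem v.
  rewrite -!stencilD; apply: eq_stencil => r _.
  exact: add_remainder.
have FEN : stencil R (F ^~ (x - u)) = stencil R (F ^~ x) - e + rem (- u).
  apply: (etrans (FE (- u))); congr (_ + _ + _).
  rewrite -stencilN; apply: eq_stencil => -[[rho a] b] _ /=.
  have dY := (CY.2 (zvec K rho)).1 x; have dP := CP.1 x.
  have dDP := (CP.2 (zvec K rho)).1 x.
  by rewrite !deriveNv// !scalerN !opprD.
apply: le_trans (potential_second_difference CV V1 V2 (FE u) FEN) _.
rewrite ler_wpM2l// -addrA lerD//.
  by rewrite ler_wpM2l// lerXn2r ?nnegrE ?mulr_ge0// ler_wpM2l.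
by rewrite mulr2n mulrDl !mul1r lerD// ler_wpM2l// remE// normrN.
Qed.

Lemma is_derive_dirZ (g : 'cV[K]_d -> 'cV[K]_d) (v x : 'cV[K]_d) (a c : K) :
  differentiable g x ->
  is_derive x (c *: v) (fun y => a *: g y) ((a * c) *: 'D_v g x).
Proof.
move=> dg; rewrite -scalerA; apply: is_deriveZ; apply: DeriveDef.
  exact: diff_derivable.
by rewrite !deriveE// linearZ.
Qed.

(** The first-order difference between the discrete and the continuum strain. *)
Definition symmetric_correction (r : bond d) x : 'cV[K]_d :=
  let: (rho, a, b) := r in
  (h / 2) *: 'D_(zvec K rho) ('D_(zvec K rho) Y) x
  + (h * ((b%:R - a%:R) / 2)) *: 'D_(zvec K rho) P x.

(** The second derivative along rho is even in rho, and the product of b - a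
    with a first derivative along rho is a product of two odd factors. *)
Lemma symmetric_correction_flip r x :
  symmetric_correction (flip r) x = symmetric_correction r x.
Proof.
case: r => [[rho a] b] /=; rewrite zvecN.
set z := zvec K rho.
have E1 : 'D_(- z) ('D_(- z) Y) x = 'D_z ('D_z Y) x.
  have DY : 'D_(- z) Y = (fun y => -1 *: 'D_z Y y).
    by apply/funext => y; rewrite scaleN1r; exact: deriveNv (CY.1 y).
  have [_] := is_derive_dirZ z (-1) (-1) ((CY.2 z).1 x).
  by rewrite -DY mulrNN mulr1 scale1r scaleN1r.
have E2 : 'D_(- z) P x = - 'D_z P x := deriveNv z (CP.1 x).
apply: (etrans (congr2 (fun u w =>
  (h / 2) *: u + (h * ((a%:R - b%:R) / 2)) *: w) E1 E2)).
by rewrite scalerN -scaleNr -mulrN -mulNr opprB.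
Qed.

Lemma symmetric_correction_le r x : r \in R ->
  `|symmetric_correction r x| <= h * (kappa * kappa * y2 + kappa * p1).
Proof.
move=> /kappaR; case: r => [[rho a] b] /= rk.
have d2 : `|'D_(zvec K rho) ('D_(zvec K rho) Y) x| <= kappa * kappa * y2.
  by apply: norm_derive2_le => //; exact: CnS.
have d1 : `|'D_(zvec K rho) P x| <= kappa * p1.
  by apply: norm_derive1_le => //; do 2 apply: CnS.
apply: norm_scale2 => //.
  by rewrite ger0_norm ?divr_ge0 ?(ltW h0)// ler_pdivrMr// ler_peMr ?(ltW h0)// ler1n.
rewrite normrM (gtr0_norm h0) ler_piMr ?(ltW h0)//; exact: bool_half_diff_le1.
Qed.

(** The derivative of P is split as (a + b) / 2 + (b - a) / 2 = b, which
    completes the difference of P to its Taylor remainder with coefficient b. *)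
Lemma discrete_strain_expansion (Y0 Yh D1 D2 P0 Ph DP : 'cV[K]_d) (a b : K) :
  h != 0 ->
  h^-1 *: (Yh - Y0) + b *: Ph - a *: P0
    - (D1 + (b - a) *: P0 + (h * ((a + b) / 2)) *: DP)
    - ((h / 2) *: D2 + (h * ((b - a) / 2)) *: DP) =
  h^-1 *: (Yh - Y0 - h *: D1 - 2^-1 *: (h ^+ 2 *: D2)) + b *: (Ph - P0 - h *: DP).
Proof. by move=> hn0; apply/matrixP => i j; rewrite !mxE; field. Qed.

Lemma discrete_strain_remainder_le r x : r \in R ->
  `|discrete_strain h Y P r x - F r x - symmetric_correction r x|
    <= h ^+ 2 * (kappa * (kappa * kappa) * y3 + kappa * kappa * p2).
Proof.
move=> /kappaR; case: r => [[rho a] b] /= rk.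
pose z := zvec K rho.
have tY : `|Y (x + h *: z) - Y x - h *: 'D_z Y x
    - 2^-1 *: (h ^+ 2 *: 'D_z ('D_z Y) x)| <= h ^+ 3 * (kappa * (kappa * kappa) * y3).
  apply: (@taylor3_mx _ _ (h *: z) _ _ Y (fun x => h *: 'D_z Y x)
    (fun x => h ^+ 2 *: 'D_z ('D_z Y) x) (fun x => h ^+ 3 *: 'D_z ('D_z ('D_z Y)) x)).
  - move=> y; have := is_derive_dirZ z 1 h (CY.1 y); rewrite mul1r.
    by congr is_derive; apply/funext => w; rewrite scale1r.
  - by move=> y; have := is_derive_dirZ z h h ((CY.2 z).1 y).
  - move=> y; have := is_derive_dirZ z (h ^+ 2) h (((CY.2 z).2 z).1 y).
    by rewrite -exprSr.
  - move=> y; rewrite normrZ ger0_norm ?exprn_ge0 ?(ltW h0)//.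
    rewrite ler_wpM2l ?exprn_ge0 ?(ltW h0)//.
    exact: norm_derive3_le.
have tP : `|P (x + h *: z) - P x - h *: 'D_z P x| <= h ^+ 2 * (kappa * kappa * p2).
  apply: (@taylor2_mx _ _ (h *: z) _ _ P (fun x => h *: 'D_z P x)
    (fun x => h ^+ 2 *: 'D_z ('D_z P) x)).
  - move=> y; have := is_derive_dirZ z 1 h (CP.1 y); rewrite mul1r.
    by congr is_derive; apply/funext => w; rewrite scale1r.
  - by move=> y; have := is_derive_dirZ z h h ((CP.2 z).1 y).
  - move=> y; rewrite normrZ ger0_norm ?exprn_ge0 ?(ltW h0)//.
    rewrite ler_wpM2l ?exprn_ge0 ?(ltW h0)//.
    by apply: norm_derive2_le => //; exact: CnS.
set u := (X in `|X|).
have -> : u = h^-1 *: (Y (x + h *: z) - Y x - h *: 'D_z Y x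
      - 2^-1 *: (h ^+ 2 *: 'D_z ('D_z Y) x))
    + b%:R *: (P (x + h *: z) - P x - h *: 'D_z P x).
  exact: discrete_strain_expansion (lt0r_neq0 h0).
apply: le_trans (ler_normD _ _) _; rewrite mulrDr lerD// normrZ.
  rewrite gtr0_norm ?invr_gt0// ler_pdivrMl//; apply: le_trans tY _.
  by rewrite (exprS h 2) -[X in X <= _]mulrA.
rewrite -[leRHS]mul1r ler_pM//; by case: b {u} => /=; rewrite ?normr1 ?normr0.
Qed.

(** Point symmetry gives equal values of V at the continuum stencil plus and
    minus the symmetric correction, so twice the error is a second difference
    of V, up to the second-order remainder. *)
Lemma site_error x : point_symmetric V ->
  `|V (stencil R (fun r => discrete_strain h Y P r x)) - V (stencil R (F ^~ x))| <=
  L * ((Q * (h * (kappa * kappa * y2 + kappa * p1))) ^+ 2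
       + Q * (h ^+ 2 * (kappa * (kappa * kappa) * y3 + kappa * kappa * p2))).
Proof.
move=> [_ symV].
set E1 := h * _; set E2 := h ^+ 2 * _.
have E1_0 : 0 <= E1 by rewrite /E1 mulr_ge0 ?(ltW h0)// addr_ge0 ?mulr_ge0.
have E2_0 : 0 <= E2 by rewrite /E2 mulr_ge0 ?exprn_ge0 ?(ltW h0)// addr_ge0 ?mulr_ge0.
pose e := stencil R (symmetric_correction ^~ x).
pose rem := stencil R (fun r =>
  discrete_strain h Y P r x - F r x - symmetric_correction r x).
have eE : `|e| <= E1.
  by apply: stencil_norm_le => // r rR; exact: symmetric_correction_le.
have remE : `|rem| <= E2.
  by apply: stencil_norm_le => // r rR; exact: discrete_strain_remainder_le.
have DE : stencil R (fun r => discrete_strain h Y P r x) =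
    stencil R (F ^~ x) + e + rem.
  by rewrite -!stencilD; apply: eq_stencil => r _; exact: add_remainder.
have sym : V (stencil R (F ^~ x) - e) = V (stencil R (F ^~ x) + e).
  rewrite -stencilN -!stencilD symV; congr V; apply: eq_stencil => r _.
  rewrite symmetric_correction_flip /F scaled_strain_flip; last 2 first.
  - by do 2 apply: CnS.
  - by do 2 apply: CnS.
  by rewrite opprD !opprK.
have lip := potential_lipschitz CV V1 (stencil R (F ^~ x) + e) rem.
(* V at the mirror image of the stencil is evaluated without a remainder. *)
have := potential_second_difference CV V1 V2 DE (esym (addr0 _)).
rewrite sym normr0 mulr0 addr0 DE => sd.
set A := V (stencil R (F ^~ x)) in sd *.
set G1 := V (_ + rem) in sd lip *; set G2 := V (_ + e) in sd lip.
have QE : (Q * `|e|) ^+ 2 <= (Q * E1) ^+ 2.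
  have Qe0 : 0 <= Q * `|e| by exact: mulr_ge0.
  have QeE : Q * `|e| <= Q * E1 by exact: ler_wpM2l.
  by rewrite !expr2; exact: ler_pM.
have Qr : Q * `|rem| <= Q * E2 by rewrite ler_wpM2l.
have LQE := ler_wpM2l L_0 QE; have LQr := ler_wpM2l L_0 Qr.
have : `|2 * (G1 - A)| <= `|G1 + G2 - 2 * A| + `|G1 - G2|.
  rewrite (_ : 2 * _ = (G1 + G2 - 2 * A) + (G1 - G2)); last by ring.
  exact: ler_normD.
rewrite normrM (gtr0_norm (ltr0n K 2)).
move: sd lip LQE LQr; rewrite -/Q; lra.
Qed.

Let W : K := (Q + 1) ^+ 2 * kappa ^+ 4.
Let T : K := y3 + p3 + p2 + y2 ^+ 2 + p1 ^+ 2.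

Lemma site_error_le x : point_symmetric V ->
  `|V (stencil R (fun r => discrete_strain h Y P r x)) - V (stencil R (F ^~ x))| <=
  2 * L * W * h ^+ 2 * T.
Proof.
move=> symV; apply: le_trans (site_error x symV) _.
by apply: site_constant => //; exact: ltW.
Qed.

Hypotheses (h1 : h <= 1) (V0 : forall G, `|V G| <= L).
Hypothesis kappad : (d * 1)%:R <= kappa.

(** For h ^+ 2 * p2 <= 1 this is the Taylor estimate.  Otherwise the right-hand
    side is at least 8 L and the bound L on V gives 4 L. *)
Lemma coordinate_second_difference_le i s u x : 0 <= s <= 1 ->
  u = (s * h) *: delta_mx i 0 ->
  `|V (stencil R (F ^~ (x + u))) + V (stencil R (F ^~ (x - u)))
     - 2 * V (stencil R (F ^~ x))| <= 8 * L * W * h ^+ 2 * T.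
Proof.
move=> /andP[s0 s1] uE; have h00 := ltW h0.
have [hp2|hp2] := leP (h ^+ 2 * p2) 1.
  have ue : (d * 1)%:R * `|u| <= kappa * h.
    apply: ler_pM => //; rewrite uE normrZ -[leRHS]mulr1; apply: ler_pM => //.
      by rewrite ger0_norm ?mulr_ge0// ler_piMl.
    apply: mx_norm_le => // k l; rewrite mxE.
    by case: (_ && _); rewrite ?normr1 ?normr0.
  apply: le_trans (energy_density_second_difference x ue) _.
  exact: step_constant.
have W1 : 1 <= W by exact: weight_ge1.
have p2T : p2 <= T.
  by rewrite /T; move: y3_0 p3_0 (sqr_ge0 y2) (sqr_ge0 p1); lra.
have hT : 1 <= W * (h ^+ 2 * T).
  rewrite -[leLHS]mulr1; apply: ler_pM => //.
  by apply: le_trans (ltW hp2) _; rewrite ler_wpM2l// sqr_ge0.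
have LT : L <= L * (W * (h ^+ 2 * T)) by rewrite ler_peMr.
have -> : 8 * L * W * h ^+ 2 * T = 8 * (L * (W * (h ^+ 2 * T))) by ring.
exact: bounded_second_difference (V0 _) (V0 _) (V0 _) LT.
Qed.

End estimates.

(** * Comparison of the energies *)

Section energies.
Context (K : realType) (d : nat).

Lemma vec_of_tuple_upd (t : d.-tuple (measurableTypeR K)) i (x s : K) :
  vec_of_tuple (upd t i (x + s)) = vec_of_tuple (upd t i x) + s *: delta_mx i 0.
Proof.
apply/matrixP => j k; rewrite !mxE !tnth_mktuple (ord1 k) eqxx andbT.
by case: eqP => _; rewrite ?mulr1 ?mulr0 ?addr0.
Qed.

Lemma sum_cV_tuple N (G : 'cV['I_N]_d -> K) :
  \sum_(xi : 'cV['I_N]_d) G xi = \sum_(t : d.-tuple 'I_N) G (\col_i tnth t i).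
Proof.
rewrite (reindex (fun t : d.-tuple 'I_N => \col_i tnth t i))//=.
exists (fun xi : 'cV['I_N]_d => [tuple xi i 0 | i < d]) => [t|xi] _.
  by apply: eq_from_tnth => i; rewrite tnth_mktuple mxE.
by apply/matrixP => i j; rewrite mxE tnth_mktuple (ord1 j).
Qed.

Lemma zvec_grid N (t : d.-tuple 'I_N) :
  zvec K (map_mx (fun i : 'I_N => i%:Z) (\col_i tnth t i)) = vec_of_tuple (grid K t).
Proof. by apply/matrixP => i j; rewrite !mxE tnth_map. Qed.

Lemma derive_periodic (W : normedModType K) (f : 'cV[K]_d -> W) (eta v x : 'cV[K]_d)
    (c : W) : (forall y, f (y + eta) = c + f y) -> 'D_v f (x + eta) = 'D_v f x.
Proof.
move=> fp.
have E : (fun h : K => h^-1 *: ((f \o shift (x + eta)) (h *: v) - f (x + eta))) =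
    (fun h : K => h^-1 *: ((f \o shift x) (h *: v) - f x)).
  apply/funext => h /=.
  by rewrite addrA !fp opprD addrA [c + _]addrC addrK.
by rewrite /derive E.
Qed.

(** Y is periodic only up to an additive constant, which disappears in its
    derivatives. *)
Lemma scaled_strain_periodic h B Y P r x (eta : 'cV[int]_d) :
  periodic_fields 1 B Y P ->
  scaled_strain h Y P r (x + zvec K eta) = scaled_strain h Y P r x :> 'cV[K]_d.
Proof.
move=> YP; case: r => [[rho a] b] /=.
have Yp y : Y (y + zvec K eta) = B *m zvec K eta + Y y.
  by have [_] := YP y eta; rewrite !scale1r.
have Pp y : P (y + zvec K eta) = 0 + P y.
  by have [+ _] := YP y eta; rewrite !scale1r add0r.
by rewrite (derive_periodic _ _ Yp) (derive_periodic _ _ Pp) Pp add0r.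
Qed.

Lemma periodic_midpoint_rule N (G : 'cV[K]_d -> K) (c M : K) : (0 < N)%N ->
  let h : K := N%:R^-1 in
  (forall z v, continuous (fun s : K => G (z + s *: v))) ->
  (forall x (eta : 'cV[int]_d), G (x + zvec K eta) = G x) ->
  (forall i s u x, 0 <= s <= 1 -> u = (s * h) *: delta_mx i 0 ->
    `|G (x + u) + G (x - u) - 2 * G x| <= M) ->
  (forall x, `|G x| <= c) ->
  `|\sum_(t : d.-tuple 'I_N) G (h *: vec_of_tuple (grid K t))
     - \int[lebesgue_tuple K d]_(t in cube N) G (h *: vec_of_tuple t)|
    <= d%:R * N%:R ^+ d * M.
Proof.
move=> N0 h cG pG dG Gc.
have hN : h * N%:R = 1 by rewrite mulVf// pnatr_eq0 -lt0n.
have updE t i x s : h *: vec_of_tuple (upd t i (x + s)) =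
    h *: vec_of_tuple (upd t i x) + (s * h) *: delta_mx i 0 :> 'cV[K]_d.
  by rewrite vec_of_tuple_upd scalerDr scalerA [h * s]mulrC.
apply: (@tensor_midpoint_rule K d N (fun t => G (h *: vec_of_tuple t)) c M) =>
  [t i|t i x|t i x s s01|t]; last exact: Gc.
- have -> : (fun x : K => G (h *: vec_of_tuple (upd t i x))) =
      (fun x : K => G (h *: vec_of_tuple (upd t i 0) + x *: (h *: delta_mx i 0))).
    by apply/funext => x; rewrite -[x in LHS]add0r updE scalerA.
  exact: cG.
- rewrite updE [N%:R * h]mulrC hN scale1r.
  rewrite -(pG (h *: vec_of_tuple (upd t i x)) (delta_mx i 0)); congr (G (_ + _)).
  apply/matrixP => j k; rewrite !mxE; by case: (_ && _).
- rewrite !updE mulNr scaleNr.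
  exact: (dG i s _ _ s01 (erefl _)).
Qed.

Lemma continuous_stencil (R : {fset bond d}) (g : K -> bond d -> 'cV[K]_d) :
  (forall r s, derivable (fun s => g s r) s 1) ->
  continuous (fun s : K => stencil R (g s)).
Proof.
move=> dg s; apply: differentiable_continuous; apply/derivable1_diffP.
apply/derivable_mxP => i j.
have -> : (fun x => stencil R (g x) i j) =
    (fun x => g x (tnth (in_tuple R) j) i 0) by apply/funext => x; rewrite mxE.
exact: (derivable_mxP _ _ _).1 (dg _ _) i 0.
Qed.

Lemma continuous_energy_density (R : {fset bond d}) (V : 'M[K]_(d, #|` R|) -> K)
    (Y P : 'cV[K]_d -> 'cV[K]_d) (h : K) (z v : 'cV[K]_d) :
  continuous V -> Cn 3 Y -> Cn 3 P ->
  continuous (fun s : K => V (stencil R (fun r => scaled_strain h Y P r (z + s *: v)))).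
Proof.
move=> cV CY CP s.
apply: (@continuous_comp _ _ _
  (fun s : K => stencil R (fun r => scaled_strain h Y P r (z + s *: v))) V); last first.
  exact: cV.
apply: (@continuous_stencil R (fun s r => scaled_strain h Y P r (z + s *: v))) => r x.
by have [] := is_derive_line (is_derive_strain h CY CP v r (z + x *: v)).
Qed.

Lemma average_error N (A A' : d.-tuple 'I_N -> K) (I e1 e2 : K) : (0 < N)%N ->
  (forall t, `|A t - A' t| <= e1) ->
  `|\sum_t A' t - I| <= d%:R * N%:R ^+ d * e2 ->
  N%:R ^- d * `|\sum_t A t - I| <= e1 + d%:R * e2.
Proof.
move=> N0 site quad.
have Nd : 0 < N%:R ^+ d :> K by rewrite exprn_gt0// ltr0n.
rewrite ler_pdivrMl// -(subrKA (\sum_t A' t)) (le_trans (ler_normD _ _))//.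
rewrite mulrDr lerD//; last by rewrite mulrCA mulrA.
rewrite -sumrB (le_trans (ler_norm_sum _ _ _))//.
have -> : N%:R ^+ d * e1 = \sum_(t : d.-tuple 'I_N) e1.
  by rewrite sumr_const card_tuple card_ord -[RHS]mulr_natl natrX.
exact: ler_sum.
Qed.

Lemma energy_error (R : {fset bond d}) (V : 'M[K]_(d, #|` R|) -> K) (B : 'M[K]_d)
    (Y P : 'cV[K]_d -> 'cV[K]_d) (L y2 y3 p1 p2 p3 kappa : K) (N : nat) :
  Cn 2 V -> (forall G, `|V G| <= L) -> nabla_le 1 V L -> nabla_le 2 V L ->
  point_symmetric V ->
  Cn 3 Y -> Cn 3 P -> periodic_fields 1 B Y P ->
  nabla_le 2 Y y2 -> nabla_le 3 Y y3 ->
  nabla_le 1 P p1 -> nabla_le 2 P p2 -> nabla_le 3 P p3 ->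
  (forall r : bond d, r \in R -> (d * 1)%:R * `|zvec K r.1.1| <= kappa) ->
  1 <= kappa -> (d * 1)%:R <= kappa -> (0 < N)%N ->
  N%:R ^- d * `|energy_a V N (atomistic (rescale_deformation N Y) (rescale_shift N P))
                - energy_c V N (rescale_deformation N Y) (rescale_shift N P)|
  <= (2 + 8 * d%:R) * (((d * #|` R|)%:R + 1) ^+ 2 * kappa ^+ 4) * L * N%:R ^- 2
     * (y3 + p3 + p2 + y2 ^+ 2 + p1 ^+ 2).
Proof.
move=> CV V0 V1 V2 symV CY CP YP Y2 Y3 P1 P2 P3 kR k1 kd N0.
set W := _ ^+ 2 * _; set T := _ + p1 ^+ 2.
pose h : K := N%:R^-1.
have NK : 0 < N%:R :> K by rewrite ltr0n.
have h0 : 0 < h by rewrite invr_gt0.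
have h1 : h <= 1 by rewrite invf_le1// ler1n.
pose G x := V (stencil R (fun r => scaled_strain h Y P r x)).
have CY1 : Cn 1 Y by do 2 apply: CnS.
have CP1 : Cn 1 P by do 2 apply: CnS.
have EcE : energy_c V N (rescale_deformation N Y) (rescale_shift N P) =
    \int[lebesgue_tuple K d]_(t in cube N) G (h *: vec_of_tuple t).
  apply: eq_Rintegral => t _.
  exact: (congr1 V (eq_stencil (fun r _ => cdiff_rescale r _ N0 CY1 CP1))).
have EaE : energy_a V N (atomistic (rescale_deformation N Y) (rescale_shift N P)) =
    \sum_(t : d.-tuple 'I_N) V (stencil R
      (fun r => discrete_strain h Y P r (h *: vec_of_tuple (grid K t)))).
  rewrite /energy_a sum_cV_tuple; apply: eq_bigr => t _.
  apply: (congr1 V); apply: eq_stencil => r _.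
  apply: (etrans (fdiff_atomistic Y P r _ N0)).
  exact: (congr1 (fun z => discrete_strain h Y P r (h *: z)) (zvec_grid t)).
have quad := @periodic_midpoint_rule N G L (8 * L * W * h ^+ 2 * T) N0.
have {}quad := quad
  (fun z v => @continuous_energy_density R V Y P h z v (CnS (CnS CV)) CY CP).
have pG (x : 'cV[K]_d) (eta : 'cV[int]_d) : G (x + zvec K eta) = G x.
  apply: (congr1 V); apply: eq_stencil => r _; exact: scaled_strain_periodic YP.
have {}quad := quad pG
  (fun i s u x s01 uE => coordinate_second_difference_le CV V1 V2 CY CP Y2 Y3 P1 P2 P3
     h0 kR k1 h1 V0 kd x s01 uE) (fun x => V0 _).
have site (t : d.-tuple 'I_N) := site_error_le CV V1 V2 CY CP Y2 Y3 P1 P2 P3 h0 kR k1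
  (h *: vec_of_tuple (grid K t)) symV.
rewrite EaE EcE; apply: le_trans (average_error N0 site quad) _.
rewrite le_eqVlt; apply/orP; left; apply/eqP.
by rewrite /h exprVn /W /T; ring.
Qed.

End energies.

(** * From suprema to the estimate *)

Section sup_norms.
Context (K : realType).

Lemma nabla_le_Cn_norm (m n k j : nat) (W : normedModType K) (f : 'M[K]_(m, n) -> W) :
  (j <= k)%N -> Cn_norm k f \is a fin_num -> nabla_le j f (fine (Cn_norm k f)).
Proof.
move=> jk ff x; rewrite -lee_fin fineK//.
apply: (@le_trans _ _ (nabla_sup j f)); first by apply: ereal_sup_ubound; exists x.
rewrite /Cn_norm (bigD1 (Ordinal (jk : (j < k.+1)%N)))//= leeDl//.
by apply: sume_ge0 => i _; exact: nabla_sup_ge0.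
Qed.

Lemma norm_le_nabla0 (m n : nat) (W : normedModType K) (f : 'M[K]_(m, n) -> W) (b : K) :
  nabla_le 0 f b -> forall x, `|f x| <= b.
Proof.
move=> fb x; apply: le_trans (fb x).
exact: (le_bigmax _ (fun s : 0.-tuple _ => `|partial s f x|) [tuple]).
Qed.

Lemma finite_error_sum (a b c x y : \bar K) :
  (0 <= a -> 0 <= b -> 0 <= c -> 0 <= x -> 0 <= y ->
  a + b + c + x ^+ 2 + y ^+ 2 < +oo ->
  [/\ a \is a fin_num, b \is a fin_num, c \is a fin_num, x \is a fin_num
    & y \is a fin_num])%E.
Proof.
move=> a0 b0 c0 x0 y0.
have sq (z : \bar K) : (0 <= z -> 0 <= z ^+ 2)%E by move=> z0; rewrite expe2 mule_ge0.
have sqoo (z : \bar K) : (0 <= z -> z ^+ 2 < +oo -> z \is a fin_num)%E.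
  by case: z => //=; rewrite ?expe2 ?mulyy ?ltxx// => _ _.
have ab := adde_ge0 a0 b0; have abc := adde_ge0 ab c0.
have abcx := adde_ge0 abc (sq x x0).
move=> oo; have := oo; move/(le_lt_trans (leeDl _ (sq y y0))) => oo4.
have := oo4; move/(le_lt_trans (leeDl _ (sq x x0))) => oo3.
have := oo3; move/(le_lt_trans (leeDl _ c0)) => oo2.
split.
- by rewrite ge0_fin_numE// (le_lt_trans (leeDl _ b0)).
- by rewrite ge0_fin_numE// (le_lt_trans (leeDr _ a0)).
- by rewrite ge0_fin_numE// (le_lt_trans (leeDr _ ab)).
- by apply: sqoo => //; exact: le_lt_trans (leeDr _ abc) oo4.
- by apply: sqoo => //; exact: le_lt_trans (leeDr _ abcx) oo.
Qed.
End sup_norms.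

Theorem theorem6p1 (K : realType) (d : nat) (hd : (1 <= d <= 3)%N)
    (R : {fset bond d}) (hR : interaction_range R) :
  exists C : K -> K,
  forall (V : 'M[K]_(d, #|` R|) -> K),
    Cn 3 V -> point_symmetric V -> Cn_norm 2 V \is a fin_num ->
  forall (B : 'M[K]_d) (Y P : 'cV[K]_d -> 'cV[K]_d),
    Cn 3 Y -> Cn 3 P -> B \in unitmx -> periodic_fields 1 B Y P ->
  forall N : nat, (0 < N)%N ->
    ((N%:R ^- d * `|energy_a V N (atomistic (rescale_deformation N Y) (rescale_shift N P))
                    - energy_c V N (rescale_deformation N Y) (rescale_shift N P)|)%:E
     <= (C (fine (Cn_norm 2 V)) * N%:R ^- 2)%:E
        * (nabla_sup 3 Y + nabla_sup 3 P + nabla_sup 2 P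
           + nabla_sup 2 Y ^+ 2 + nabla_sup 1 P ^+ 2))%E.
Proof.
pose range : K := \sum_(r <- R) `|zvec K r.1.1|.
have range_ge (r : bond d) : r \in R -> `|zvec K r.1.1| <= range.
  by move=> rR; rewrite /range (big_rem r)//= lerDl sumr_ge0.
have range0 : 0 <= range by exact: sumr_ge0.
(* Large enough to dominate d times the length of every bond, d and 1. *)
pose kappa : K := (d * 1)%:R * (range + 1) + 1.
have d0 : 0 <= (d * 1)%:R :> K by exact: ler0n.
have k1 : 1 <= kappa by rewrite lerDr mulr_ge0// addr_ge0.
have kd : (d * 1)%:R <= kappa.
  by have := mulr_ge0 d0 range0; rewrite /kappa mulrDr; lra.
have kR (r : bond d) : r \in R -> (d * 1)%:R * `|zvec K r.1.1| <= kappa.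
  move=> /range_ge rR; have := ler_wpM2l d0 rR; rewrite /kappa mulrDr.
  by move: d0; lra.
pose W : K := ((d * #|` R|)%:R + 1) ^+ 2 * kappa ^+ 4.
have W0 : 0 < W.
  by apply: lt_le_trans ltr01 _; apply: weight_ge1 => //; exact: ler0n.
(* 2 from the grid points, 8 from each coordinate of the midpoint rule; the
   summand 1 keeps the constant positive when V = 0. *)
exists (fun L => (2 + 8 * d%:R) * W * (`|L| + 1)).
move=> V CV symV Vfin B Y P CY CP _ YP N N0.
set L := fine (Cn_norm 2 V).
have NK : 0 < N%:R ^- 2 :> K by rewrite invr_gt0 exprn_gt0// ltr0n.
set C := _ * (`|L| + 1).
have C0 : 0 < C.
  have a0 : 0 < 2 + 8 * d%:R :> K by have := ler0n K d; lra.
  have b0 : 0 < `|L| + 1 by have := normr_ge0 L; lra.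
  exact: (mulr_gt0 (mulr_gt0 a0 W0) b0).
have C1 : (2 + 8 * d%:R) * W * L <= C.
  rewrite /C ler_wpM2l//; first by rewrite mulr_ge0 ?(ltW W0)// addr_ge0// mulr_ge0.
  by rewrite (le_trans (ler_norm L))// lerDl.
set S := (_ + nabla_sup 1 P ^+ 2)%E.
have [->|Soo] := eqVneq S +oo%E.
  by rewrite gt0_muley ?leey// lte_fin mulr_gt0.
have [] := @finite_error_sum K (nabla_sup 3 Y) (nabla_sup 3 P) (nabla_sup 2 P)
  (nabla_sup 2 Y) (nabla_sup 1 P) (nabla_sup_ge0 _ _) (nabla_sup_ge0 _ _)
  (nabla_sup_ge0 _ _) (nabla_sup_ge0 _ _) (nabla_sup_ge0 _ _).
  by rewrite ltey.
move=> Y3 P3 P2 Y2 P1.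
have V0 := norm_le_nabla0 (nabla_le_Cn_norm (isT : (0 <= 2)%N) Vfin).
have V1 := nabla_le_Cn_norm (isT : (1 <= 2)%N) Vfin.
have V2 := nabla_le_Cn_norm (isT : (2 <= 2)%N) Vfin.
have err := energy_error (CnS CV) V0 V1 V2 symV CY CP YP (nabla_le_sup Y2)
  (nabla_le_sup Y3) (nabla_le_sup P1) (nabla_le_sup P2) (nabla_le_sup P3) kR k1 kd N0.
rewrite /S -(fineK Y3) -(fineK P3) -(fineK P2) -(fineK Y2) -(fineK P1).
rewrite -!EFin_expe -!EFinD -EFinM lee_fin; apply: le_trans err _.
have T0 : 0 <= fine (nabla_sup 3 Y) + fine (nabla_sup 3 P) + fine (nabla_sup 2 P)
    + fine (nabla_sup 2 Y) ^+ 2 + fine (nabla_sup 1 P) ^+ 2.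
  by rewrite !addr_ge0 ?sqr_ge0 ?fine_ge0 ?nabla_sup_ge0.
by rewrite ler_wpM2r// ler_wpM2r// ltW.
Qed.
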